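(* Let $t\neq 0,1$. Let $$K(x_1,x_2,y,q_1,q_2)=(x_1x_2)^{1-s_1}\big((x_1-1)(x_2-1)\big)^{1-s_2}\big((x_1-t)(x_2-t)\big)^{1-s_3}\,(1-q_1-q_2)^{s_1-r-1}q_1^{s_2-r}q_2^{s_3-r}(q_1q_2+vq_1+uq_2)^{r-2},$$ where $$u=\frac{(x_1-1)(x_2-1)(y-1)}{(t-1)^2},\qquad v=\frac{(x_1-t)(x_2-t)(y-t)}{t(t-1)^2},$$ and $s_1,s_2,s_3,r$ are arbitrary constants. Then there exists a birational mapping $$\mu:(y,q_1,q_2,q_3,q_4)\mapsto(\tilde y,\tilde q_1,\tilde q_2,\tilde q_3,\tilde q_4)$$ of $5$-dimensional affine space, depending on $x_1,x_2,x_3,z$ (and not depending on $s_1,s_2,s_3,r$), which transforms the left-hand side of the equation $$K(x_1,x_2,y,q_1,q_2)\,K(y,x_3,z,q_3,q_4)\;dy\wedge dq_1\wedge dq_2\wedge dq_3\wedge dq_4=\pm K(x_1,x_3,\tilde y,\tilde q_1,\tilde q_2)\,K(\tilde y,x_2,z,\tilde q_3,\tilde q_4)\;d\tilde y\wedge d\tilde q_1\wedge d\tilde q_2\wedge d\tilde q_3\wedge d\tilde q_4$$ to its right-hand side.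
   Context: The ground field $k$ has characteristic zero, $t\in k$, and $x_1,x_2,x_3,z$ are generic parameters (independent variables), on which the coefficients of $\mu$ depend rationally. In $K(y,x_3,z,q_3,q_4)$ the arguments are substituted everywhere, including in $u$ and $v$; so there $u=\frac{(y-1)(x_3-1)(z-1)}{(t-1)^2}$ and $v=\frac{(y-t)(x_3-t)(z-t)}{t(t-1)^2}$. The constants $s_1,s_2,s_3,r$ symbolize a generic character of $\mathbb{G}_m^4$, and powers are treated formally. Collecting exponents, the left-hand side is written as $f_1^{s_1}f_2^{s_2}f_3^{s_3}f_4^{r}\,h\,dy\wedge dq_1\wedge dq_2\wedge dq_3\wedge dq_4$ with rational functions $f_1,\dots,f_4,h$ independent of $s_1,s_2,s_3,r$. The right-hand side is written in the same way with $\tilde f_1,\dots,\tilde f_4,\tilde h$, obtained from $f_1,\dots,f_4,h$ by swapping $x_2$ and $x_3$ and putting tildes on $y,q_1,\dots,q_4$. That $\mu$ transforms one side to the other means that under the substitution given by $\mu$ each $f_i$ corresponds to $\tilde f_i$ ($i=1,\dots,4$), and $h\,dy\wedge dq_1\wedge\cdots\wedge dq_4$ corresponds to $\pm\tilde h\,d\tilde y\wedge d\tilde q_1\wedge\cdots\wedge d\tilde q_4$. *)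

(* Defs.v *)
From mathcomp Require Import all_boot all_order all_algebra.
From mathcomp.multinomials Require Export mpoly.

Set Implicit Arguments.
Unset Strict Implicit.
Unset Printing Implicit Defensive.

Import GRing.Theory.
Local Open Scope ring_scope.

Notation ratfun F n := {fraction {mpoly F[n]}}.
Local Notation "x %:F" := (FracField.tofrac x).

Section RationalMaps.
Variables (F : fieldType) (n : nat).
Local Notation L := (ratfun F n).

Definition rcst (c : F) : L := (c%:MP)%:F.
Definition rvar (i : 'I_n) : L := ('X_i)%:F.

Definition pull_poly (m : 'I_n -> L) (p : {mpoly F[n]}) : L := mmap rcst m p.

(* A rational self-map of affine n-space over F is the n-tuple m of its
   coordinate functions; it is dominant iff no nonzero polynomial vanishes
   identically on its image. *)
Definition dominant (m : 'I_n -> L) : Prop :=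
  forall p : {mpoly F[n]}, p != 0 -> pull_poly m p != 0.

(* The composite "f after m". It does not depend on the chosen fraction for f
   when m is dominant; otherwise the denominator may pull back to 0, and the
   value is meaningless. *)
Definition pull (m : 'I_n -> L) (f : L) : L :=
  pull_poly m \n_(repr f) / pull_poly m \d_(repr f).

Definition birational (m : 'I_n -> L) : Prop :=
  dominant m /\
  exists m' : 'I_n -> L,
    [/\ dominant m',
        forall i, pull m (m' i) = rvar i &
        forall i, pull m' (m i) = rvar i].

Definition rderiv (i : 'I_n) (f : L) : L :=
  let a := \n_(repr f) in let b := \d_(repr f) in
  (a^`M(i) * b - a * b^`M(i))%:F / (b ^+ 2)%:F.

Definition jacobian (m : 'I_n -> L) : 'M[L]_n :=
  \matrix_(i, j) rderiv j (m i).

(* The rational n-form h dX_0 /\ ... /\ dX_(n-1) is represented by its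
   coefficient h; this is the coefficient of its pull-back by m. *)
Definition pull_form (m : 'I_n -> L) (h : L) : L :=
  pull m h * \det (jacobian m).

End RationalMaps.

(* An exponent c + a1 s1 + a2 s2 + a3 s3 + b r, with s1, s2, s3, r formal
   symbols, is the row vector (c, a1, a2, a3, b). *)
Notation exponent := 'rV[int]_5.
Definition one : exponent := delta_mx 0 0.
Definition s1 : exponent := delta_mx 0 1.
Definition s2 : exponent := delta_mx 0 2.
Definition s3 : exponent := delta_mx 0 3.
Definition r : exponent := delta_mx 0 4.

Section PowerProducts.
Variable L : fieldType.

(* The list [:: (b1, e1); ...; (bm, em)] stands for b1^e1 * ... * bm^em. *)
Definition powprod := seq (L * exponent).

(* Writing a power product as h * f1^s1 * f2^s2 * f3^s3 * f4^r, "collect 0" is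
   h and "collect i" is fi for i = 1, ..., 4. *)
Definition collect (i : 'I_5) (A : powprod) : L :=
  \prod_(be <- A) be.1 ^ (be.2 0 i).

Definition u (t x1 x2 y : L) : L :=
  (x1 - 1) * (x2 - 1) * (y - 1) / (t - 1) ^+ 2.

Definition v (t x1 x2 y : L) : L :=
  (x1 - t) * (x2 - t) * (y - t) / (t * (t - 1) ^+ 2).

Definition K (t x1 x2 y q1 q2 : L) : powprod :=
  [:: (x1 * x2, one - s1);
      ((x1 - 1) * (x2 - 1), one - s2);
      ((x1 - t) * (x2 - t), one - s3);
      (1 - q1 - q2, s1 - r - one);
      (q1, s2 - r);
      (q2, s3 - r);
      (q1 * q2 + v t x1 x2 y * q1 + u t x1 x2 y * q2, r - one *+ 2)].

End PowerProducts.

(* m carries A dX_0 /\ ... /\ dX_(n-1) on its source to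
   +- B dX_0 /\ ... /\ dX_(n-1) on its target. *)
Definition transforms (F : fieldType) (n : nat) (m : 'I_n -> ratfun F n)
    (A B : powprod (ratfun F n)) : Prop :=
  (forall i : 'I_5, i != 0 -> pull m (collect i B) = collect i A) /\
  (pull_form m (collect 0 B) = collect 0 A \/
   pull_form m (collect 0 B) = - collect 0 A).

(* Main.v *)
Require Import Defs.
From mathcomp Require Import all_boot all_order all_algebra.
From HB Require Import structures.
From mathcomp Require Import ring.

(* Up to constants, the coefficients f1, f2, f3 of s1, s2, s3 on the left-hand
   side are
     A = (1-q1-q2)(1-q3-q4)/y,  B = q1 q3/(y-1),  C = q2 q4/(y-t),
   and the form coefficient is A^-3 f4^-2 B^-2 C^-2 dy dq1 ... dq4 / (y^2(y-1)(y-t)).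
   Write u = U(y-1), v = V(y-t) for K(x1,x2,y,_,_), and U', V' for K(y,x3,z,_,_).
   The coordinates are changed one at a time, each by a Moebius transformation
   over the field of the other four:
     q3 -> B,  q4 -> C,  y -> A,  q1 -> s = (U+B) q2 + t (V+C) q1,
     q2 -> Y = (q1 (V+C) - (U C - V B)) / s,  s -> eta,
   where eta is the product of a quadratic polynomial in Y and
   (1 + U' q1/B + V' q2/C) / (1-q1-q2).  In the chart (A, eta, Y, B, C) both f4
   and the form depend on x1, x2, x3, z only through expressions symmetric in
   x2 and x3.  The map mu is this change of coordinates followed by the inverse
   of its version with x2 and x3 swapped. *)

Set Implicit Arguments.
Unset Strict Implicit.
Unset Printing Implicit Defensive.

Import GRing.Theory.
Local Open Scope ring_scope.

Local Notation "x %:F" := (FracField.tofrac x).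

(** * Fractions over an integral domain and abstract quotient rules *)

Lemma divff_eq (R : idomainType) (a b c d : R) : b != 0 -> d != 0 ->
  (a%:F / b%:F == c%:F / d%:F :> {fraction R}) = (a * d == c * b).
Proof.
move=> b0 d0; rewrite eqr_div ?tofrac_eq0 //.
by rewrite -!tofracM tofrac_eq.
Qed.

Lemma repr_fracE (R : idomainType) (f : {fraction R}) :
  f = (\n_(repr f))%:F / (\d_(repr f))%:F.
Proof.
rewrite -{1}[f]reprK; set x := repr f.
have Ed : \d_x != 0 by [].
have Ed' : (\d_x)%:F != 0 :> {fraction R} by rewrite tofrac_eq0.
apply: (mulIf Ed'); rewrite divfK //.
unlock FracField.tofrac.
rewrite -[LHS]FracField.pi_mul; apply/eqmodP.
rewrite /= FracField.equivfE /FracField.mulf.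
by rewrite !numden_Ratio ?mulf_neq0 ?oner_eq0 // !mulr1 mulrC.
Qed.

Lemma frac_ind (R : idomainType) (P : {fraction R} -> Prop) :
  (forall a b : R, b != 0 -> P (a%:F / b%:F)) -> forall f, P f.
Proof. by move=> H f; rewrite (repr_fracE f); apply: H; apply: denom_ratioP. Qed.

(** The derivatives are free letters here, so that the sum and product rules for [rderiv] become
    identities which [field] decides. *)
Lemma quotient_ruleD (K : fieldType) (a a' b b' c c' d d' : K) :
  b != 0 -> d != 0 ->
  ((a' * d + a * d' + (c' * b + c * b')) * (b * d) -
     (a * d + c * b) * (b' * d + b * d')) / (b * d) ^+ 2 =
  (a' * b - a * b') / b ^+ 2 + (c' * d - c * d') / d ^+ 2.
Proof. by move=> b0 d0; field; rewrite b0 d0. Qed.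

Lemma quotient_ruleM (K : fieldType) (a a' b b' c c' d d' : K) :
  b != 0 -> d != 0 ->
  ((a' * c + a * c') * (b * d) - a * c * (b' * d + b * d')) / (b * d) ^+ 2 =
  (a' * b - a * b') / b ^+ 2 * (c / d) + a / b * ((c' * d - c * d') / d ^+ 2).
Proof. by move=> b0 d0; field; rewrite b0 d0. Qed.

(** The derivatives of numerator and denominator arrive expanded by the chain rule; this regroups
    them coordinate by coordinate. *)
Lemma quotient_rule_sum (K : fieldType) (I : finType) (a b : K)
    (a' b' x : I -> K) : b != 0 ->
  (\sum_i a' i * x i) / b + a * (- (\sum_i b' i * x i) / b ^+ 2) =
  \sum_i (a' i * b - a * b' i) / b ^+ 2 * x i.
Proof.
move=> b0; rewrite mulNr mulrN !mulr_suml mulr_sumr -sumrB.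
by apply: eq_bigr => i _; field.
Qed.

(** * Pull-back, derivations and Jacobians on the field of rational functions *)

Section Maps.
Variables (F : fieldType) (n : nat).
Local Notation L := (ratfun F n).
Implicit Types (f g : L) (p q : {mpoly F[n]}) (m : 'I_n -> L) (i j : 'I_n).

Let rcst_zmod : zmod_morphism (@rcst F n).
Proof. by move=> x y; rewrite /rcst mpolyCB tofracB. Qed.
Let rcst_monoid : monoid_morphism (@rcst F n).
Proof. by split=> [|x y]; rewrite /rcst ?mpolyCM ?tofracM. Qed.
HB.instance Definition _ := GRing.isZmodMorphism.Build F L (@rcst F n) rcst_zmod.
HB.instance Definition _ := GRing.isMonoidMorphism.Build F L (@rcst F n) rcst_monoid.

Definition pull_poly_rmorphism m : {rmorphism {mpoly F[n]} -> L} :=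
  mmap (@rcst F n) m.

Lemma pull_polyD m : {morph pull_poly m : p q / p + q}.
Proof. exact: (rmorphD (pull_poly_rmorphism m)). Qed.

Lemma pull_polyN m : {morph pull_poly m : p / - p}.
Proof. exact: (rmorphN (pull_poly_rmorphism m)). Qed.

Lemma pull_polyM m : {morph pull_poly m : p q / p * q}.
Proof. exact: (rmorphM (pull_poly_rmorphism m)). Qed.

Lemma pull_poly0 m : pull_poly m 0 = 0.
Proof. exact: (rmorph0 (pull_poly_rmorphism m)). Qed.

Lemma pull_poly1 m : pull_poly m 1 = 1.
Proof. exact: (rmorph1 (pull_poly_rmorphism m)). Qed.

Lemma pull_polyC m (c : F) : pull_poly m c%:MP = rcst n c.
Proof. exact: mmapC. Qed.

Lemma pull_polyX m i : pull_poly m 'X_i = m i.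
Proof. by rewrite /pull_poly mmapX mmap1U. Qed.

Lemma pull_poly_id p : pull_poly (@rvar F n) p = p%:F.
Proof.
elim/mpolyind: p => [|c a p _ _ IH]; first by rewrite pull_poly0 tofrac0.
rewrite -mul_mpolyC pull_polyD pull_polyM IH tofracD tofracM pull_polyC.
congr (_ * _ + _); rewrite /pull_poly mmapX /mmap1 mpolyXE_id rmorph_prod.
by apply: eq_bigr => i _; rewrite rmorphXn.
Qed.

Section Dominant.
Variable m : 'I_n -> L.
Hypothesis dom_m : dominant m.

(** Two fractions for the same function satisfy a cross-multiplied polynomial relation, which
    survives pull-back; dominance keeps both denominators nonzero. *)
Lemma pull_div p q : q != 0 -> pull m (p%:F / q%:F) = pull_poly m p / pull_poly m q.
Proof.
move=> q0; set f := _ / _.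
have d0 : \d_(repr f) != 0 by [].
have /eqP := repr_fracE f; rewrite {1}/f divff_eq // => /eqP E.
rewrite /pull -/f; apply/eqP; rewrite eqr_div ?dom_m //.
by rewrite -!pull_polyM -E.
Qed.

Lemma pull_tofrac p : pull m p%:F = pull_poly m p.
Proof.
by rewrite -[p%:F]divr1 -tofrac1 pull_div ?oner_eq0 // pull_poly1 divr1.
Qed.

Let pull_zmod : zmod_morphism (pull m).
Proof.
elim/frac_ind=> a b b0; elim/frac_ind=> c d d0.
have nz x : x != 0 -> x%:F != 0 :> L by rewrite tofrac_eq0.
rewrite -mulNr -tofracN addf_div ?nz // -!tofracM -tofracD.
rewrite !pull_div ?mulf_neq0 // pull_polyD !pull_polyM pull_polyN.
by rewrite -addf_div ?dom_m // mulNr.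
Qed.
Let pull_monoid : monoid_morphism (pull m).
Proof.
split; first by rewrite -tofrac1 pull_tofrac pull_poly1.
elim/frac_ind=> a b b0; elim/frac_ind=> c d d0.
by rewrite mulf_div -!tofracM !pull_div ?mulf_neq0 // !pull_polyM mulf_div.
Qed.

(** The morphism laws rest on the dominance of [m], so the structure is packed from that hypothesis
    rather than declared as an instance. *)
Definition pull_rmorphism : {rmorphism L -> L} :=
  HB.pack (pull m) (GRing.isZmodMorphism.Build L L _ pull_zmod)
    (GRing.isMonoidMorphism.Build L L _ pull_monoid).

Lemma pull_rvar i : pull m (rvar F i) = m i.
Proof. by rewrite pull_tofrac pull_polyX. Qed.

Lemma pull_rcst (c : F) : pull m (rcst n c) = rcst n c.
Proof. by rewrite pull_tofrac pull_polyC. Qed.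

End Dominant.

Lemma dominant_rvar : dominant (@rvar F n).
Proof. by move=> p; rewrite pull_poly_id tofrac_eq0. Qed.

Lemma rmorph_div_eq (phi psi : {rmorphism L -> L}) :
  (forall c, phi (rcst n c) = psi (rcst n c)) ->
  (forall i, phi (rvar F i) = psi (rvar F i)) -> forall f, phi f = psi f.
Proof.
move=> Ec Ei.
have E p : phi p%:F = psi p%:F.
  rewrite -pull_poly_id /pull_poly /mmap !rmorph_sum /=; apply: eq_bigr => a _.
  rewrite !rmorphM Ec /mmap1 !rmorph_prod; congr (_ * _); apply: eq_bigr => i _.
  by rewrite !rmorphXn Ei.
by elim/frac_ind=> a b b0; rewrite !fmorph_div /= !E.
Qed.

Lemma pull_id f : pull (@rvar F n) f = f.
Proof.
apply: (@rmorph_div_eq (pull_rmorphism dominant_rvar) idfun _ _ f) => [c|i].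
  exact: (pull_rcst dominant_rvar).
exact: (pull_rvar dominant_rvar).
Qed.

(** The tuple [fun i => pull m (m' i)] is the map [m] followed by [m']; pull-back reverses the
    order. *)
Lemma pull_poly_comp m m' p : dominant m ->
  pull m (pull_poly m' p) = pull_poly (fun i => pull m (m' i)) p.
Proof.
move=> dm; rewrite -[pull m _]/(pull_rmorphism dm _).
rewrite /pull_poly /mmap rmorph_sum; apply: eq_bigr => a _.
rewrite rmorphM /= pull_rcst // /mmap1; congr (_ * _).
rewrite -[LHS]/(pull_rmorphism dm _) rmorph_prod; apply: eq_bigr => i _.
exact: rmorphXn.
Qed.

Lemma dominant_comp m m' : dominant m -> dominant m' ->
  dominant (fun i => pull m (m' i)).
Proof.
move=> dm dm' p p0; rewrite -pull_poly_comp //.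
by rewrite -[pull m _]/(pull_rmorphism dm _) fmorph_eq0 dm'.
Qed.

Lemma pull_comp m m' f : dominant m -> dominant m' ->
  pull m (pull m' f) = pull (fun i => pull m (m' i)) f.
Proof.
move=> dm dm'; have dc := dominant_comp dm dm'.
elim/frac_ind: f => a b b0; rewrite !pull_div //.
rewrite -[LHS]/(pull_rmorphism dm _) fmorph_div /=.
by rewrite !pull_poly_comp.
Qed.

Lemma eq_pull m m' : m =1 m' -> pull m =1 pull m'.
Proof.
move=> E f; rewrite /pull /pull_poly.
by congr (_ / _); apply: eq_bigr => a _; congr (_ * _); apply: mmap1_eq.
Qed.

(** The derivative does not depend on the fraction: with a/b the chosen representative, p b = a q
    and the derivative of this relation turn one quotient-rule numerator into the other. *)
Lemma rderiv_div i p q : q != 0 ->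
  rderiv i (p%:F / q%:F) = (p^`M(i) * q - p * q^`M(i))%:F / (q ^+ 2)%:F.
Proof.
move=> q0; set f := _ / _.
have d0 : \d_(repr f) != 0 by [].
have /eqP := repr_fracE f; rewrite {1}/f divff_eq // => /eqP E.
rewrite /rderiv -/f; move: d0 E; set a := \n_(repr f); set b := \d_(repr f).
move=> d0 E; apply/eqP; rewrite divff_eq ?expf_neq0 //; apply/eqP.
have := congr1 (mderiv i) E; rewrite !mderivM => E'.
have -> : (a^`M(i) * b - a * b^`M(i)) * q ^+ 2 =
  b * q * (a^`M(i) * q + a * q^`M(i)) - b * q^`M(i) * (a * q) -
  q * b^`M(i) * (a * q) by ring.
by rewrite -E' -E; ring.
Qed.

Lemma rderiv_tofrac i p : rderiv i p%:F = (p^`M(i))%:F.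
Proof.
rewrite -[p%:F]divr1 -tofrac1 rderiv_div ?oner_eq0 //.
by rewrite expr1n tofrac1 divr1 mderivC mulr0 subr0 mulr1.
Qed.

Lemma rderiv_divE i p q : q != 0 -> rderiv i (p%:F / q%:F) =
  ((p^`M(i))%:F * q%:F - p%:F * (q^`M(i))%:F) / q%:F ^+ 2.
Proof. by move=> q0; rewrite rderiv_div // (tofracXn 2) tofracB !tofracM. Qed.

Lemma addf_tofrac (a b c d : {mpoly F[n]}) : b != 0 -> d != 0 ->
  a%:F / b%:F + c%:F / d%:F = (a * d + c * b)%:F / (b * d)%:F :> L.
Proof.
move=> b0 d0; have nz x : x != 0 -> x%:F != 0 :> L by rewrite tofrac_eq0.
by rewrite addf_div ?nz // tofracD !tofracM.
Qed.

Lemma mulf_tofrac (a b c d : {mpoly F[n]}) :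
  (a%:F / b%:F) * (c%:F / d%:F) = (a * c)%:F / (b * d)%:F :> L.
Proof. by rewrite mulf_div !tofracM. Qed.

Lemma rderivD i f g : rderiv i (f + g) = rderiv i f + rderiv i g.
Proof.
elim/frac_ind: f => a b b0; elim/frac_ind: g => c d d0.
have b0' : b%:F != 0 :> L by rewrite tofrac_eq0.
have d0' : d%:F != 0 :> L by rewrite tofrac_eq0.
rewrite addf_tofrac //.
rewrite (rderiv_divE i _ (mulf_neq0 b0 d0)).
rewrite (rderiv_divE i a b0).
rewrite (rderiv_divE i c d0).
rewrite mderivD !mderivM !tofracD !tofracM.
move: (a^`M(i))%:F (b^`M(i))%:F (c^`M(i))%:F (d^`M(i))%:F b0' d0'.
move: a%:F b%:F c%:F d%:F => a1 b1 c1 d1 a' b' c' d'.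
exact: quotient_ruleD.
Qed.

Lemma rderivM i f g : rderiv i (f * g) = rderiv i f * g + f * rderiv i g.
Proof.
elim/frac_ind: f => a b b0; elim/frac_ind: g => c d d0.
have b0' : b%:F != 0 :> L by rewrite tofrac_eq0.
have d0' : d%:F != 0 :> L by rewrite tofrac_eq0.
rewrite mulf_tofrac.
rewrite (rderiv_divE i _ (mulf_neq0 b0 d0)).
rewrite (rderiv_divE i a b0).
rewrite (rderiv_divE i c d0).
rewrite !mderivM !tofracD !tofracM.
move: (a^`M(i))%:F (b^`M(i))%:F (c^`M(i))%:F (d^`M(i))%:F b0' d0'.
move: a%:F b%:F c%:F d%:F => a1 b1 c1 d1 a' b' c' d'.
exact: quotient_ruleM.
Qed.

Lemma rderivC i (c : F) : rderiv i (rcst n c) = 0.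
Proof. by rewrite rderiv_tofrac mderivC tofrac0. Qed.

Lemma rderiv0 i : rderiv i (0 : L) = 0.
Proof. by have := rderivC i 0; rewrite rmorph0. Qed.

Lemma rderivN i f : rderiv i (- f) = - rderiv i f.
Proof. by apply/eqP; rewrite -addr_eq0 -rderivD addNr rderiv0. Qed.

Lemma rderivX i j : rderiv i (rvar F j) = (i == j)%:R.
Proof.
rewrite rderiv_tofrac mderivX mnmE eq_sym.
case: eqP => [->|_]; last by rewrite scale0r tofrac0.
have -> : (U_(j) - U_(j) = 0 :> 'X_{1..n})%MM.
  by apply/mnmP=> l; rewrite mnmBE subnn mnm0E.
by rewrite mpolyX0 scale1r tofrac1.
Qed.

(** Obtained by differentiating f f^-1 = 1. *)
Lemma rderivV i f : f != 0 -> rderiv i f^-1 = - rderiv i f / f ^+ 2.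
Proof.
move=> f0; have E : rderiv i (f * f^-1) = 0.
  by rewrite divff // -(rderivC i 1) /rcst mpolyC1 tofrac1.
move: E; rewrite rderivM => /eqP; rewrite addrC addr_eq0 => /eqP E.
rewrite -[LHS](mulKf f0) E mulrN mulNr; congr (- _).
by rewrite mulrCA -invfM.
Qed.

(** The chain rule holds for constants and variables and is stable under sums and products, hence
    holds for all polynomials. *)
Lemma rderiv_pull_poly m j p : rderiv j (pull_poly m p) =
  \sum_i pull_poly m p^`M(i) * rderiv j (m i).
Proof.
pose Q a := rderiv j (pull_poly m a) = \sum_i pull_poly m a^`M(i) * rderiv j (m i).
have QC (c : F) : Q c%:MP.
  rewrite /Q pull_polyC rderivC big1 // => i _.
  by rewrite mderivC pull_poly0 mul0r.
have QD a b : Q a -> Q b -> Q (a + b).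
  rewrite /Q pull_polyD rderivD => -> ->; rewrite -big_split.
  by apply: eq_bigr => i _; rewrite mderivD pull_polyD mulrDl.
have QM a b : Q a -> Q b -> Q (a * b).
  rewrite /Q pull_polyM rderivM => -> ->; rewrite mulr_suml mulr_sumr -big_split.
  apply: eq_bigr => i _; rewrite mderivM pull_polyD !pull_polyM /=.
  by move: (rderiv _ _) => x; rewrite mulrDl mulrAC mulrA.
have QX i : Q 'X_i.
  rewrite /Q pull_polyX (bigD1 i) //= big1 => [|l ne]; rewrite mderivX mnmE.
    rewrite eqxx.
    have -> : (U_(i) - U_(i) = 0 :> 'X_{1..n})%MM.
      by apply/mnmP=> l; rewrite mnmBE subnn mnm0E.
    by rewrite mpolyX0 scale1r pull_poly1 mul1r addr0.
  by rewrite eq_sym (negPf ne) scale0r pull_poly0 mul0r.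
rewrite -/(Q p); elim/mpolyind: p => [|c a p _ _ Qp]; first exact: (QC 0).
apply: (QD _ _) => //; rewrite -mul_mpolyC; apply: (QM _ _) => //.
rewrite mpolyXE_id; apply: (big_ind Q) => [||i _]; [exact: QC|exact: QM|].
by elim: (a i) => [|e IH]; [exact: QC | rewrite exprS; apply: QM].
Qed.

Lemma rderiv_pull m j f : dominant m -> rderiv j (pull m f) =
  \sum_i pull m (rderiv i f) * rderiv j (m i).
Proof.
move=> dm; elim/frac_ind: f => a b b0; rewrite pull_div // rderivM rderivV ?dm //.
rewrite !rderiv_pull_poly quotient_rule_sum ?dm //.
apply: eq_bigr => i _; rewrite rderiv_div // pull_div ?expf_neq0 //.
by rewrite pull_polyD pull_polyN !pull_polyM.
Qed.

Lemma jacobian_comp m m' : dominant m ->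
  jacobian (fun i => pull m (m' i)) =
  map_mx (pull m) (jacobian m') *m jacobian m.
Proof.
move=> dm; apply/matrixP=> i j; rewrite !mxE rderiv_pull //.
by apply: eq_bigr => l _; rewrite !mxE.
Qed.

Lemma det_jacobian_comp m m' : dominant m ->
  \det (jacobian (fun i => pull m (m' i))) =
  pull m (\det (jacobian m')) * \det (jacobian m).
Proof.
move=> dm; rewrite jacobian_comp // det_mulmx.
by rewrite -[map_mx _ _]/(map_mx (pull_rmorphism dm) _) det_map_mx.
Qed.

Lemma jacobian_rvar : jacobian (@rvar F n) = 1%:M.
Proof. by apply/matrixP=> i j; rewrite !mxE rderivX eq_sym. Qed.

(* In characteristic 0 a nonzero polynomial has a nonzero constant among its
   iterated derivatives, while an invertible Jacobian makes the ideal of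
   relations between the coordinates of m stable under derivation. *)
Lemma dominant_det m : [pchar F] =i pred0 -> \det (jacobian m) != 0 -> dominant m.
Proof.
move=> ch0 dJ p p0; apply/eqP=> E.
have st q i : pull_poly m q = 0 -> pull_poly m q^`M(i) = 0.
  move=> Eq; pose w : 'rV[L]_n := \row_i pull_poly m q^`M(i).
  have wJ : w *m jacobian m = 0.
    apply/rowP=> j; rewrite !mxE -[RHS](rderiv0 j) -[in RHS]Eq rderiv_pull_poly.
    by apply: eq_bigr => l _; rewrite !mxE.
  have : w = 0.
    have uJ : jacobian m \in unitmx by rewrite unitmxE unitfE.
    by rewrite -[w](mulmxK uJ) wJ mul0mx.
  by move=> /rowP /(_ i); rewrite !mxE.
have stm a : pull_poly m p^`M[a] = 0.
  rewrite mderivm_foldr; elim: (flatten _) => //= i s; exact: st.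
have := stm (mlead p).
(* Differentiating along the leading exponent leaves a constant: the coefficient at a nonzero
   exponent a comes from that of p at [mlead p + a], beyond the leading monomial. The constant is
   the leading coefficient times a product of factorials. *)
have -> : p^`M[mlead p] = (p^`M[mlead p]@_0%MM)%:MP.
  apply/mpolyP=> a; rewrite mcoeffC; case: eqP => [<-|ne]; first by rewrite mulr1.
  rewrite mulr0 mcoeff_mderivm (mcoeff_gt_mlead (p := p)) ?mul0rn //.
  rewrite Order.POrderTheory.lt_neqAle lemc_addr andbT; apply/eqP=> Ea; apply: ne.
  apply/mnmP=> l; have /mnmP /(_ l) := Ea; rewrite mnmDE mnm0E.
  by rewrite -{1}[mlead p l]addn0 => /addnI.
rewrite pull_polyC => /eqP; rewrite fmorph_eq0 mcoeff_mderivm addm0.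
rewrite -mulr_natr mulf_eq0 mleadc_eq0 (negPf p0) /=.
have /pcharf0P -> := ch0; apply/negP; rewrite -lt0n.
by apply: prodn_gt0 => i; rewrite ffactnn fact_gt0.
Qed.

End Maps.

(** * Derivative and inverse of a Moebius transformation *)

Lemma moebius_deriv (K : fieldType) (a b c e x : K) : c * x + e != 0 ->
  a / (c * x + e) + (a * x + b) * (- c / (c * x + e) ^+ 2) =
  (a * e - b * c) / (c * x + e) ^+ 2.
Proof. by move=> D0; field. Qed.

(** The inverse is given by the adjugate matrix, since the determinant cancels in the quotient. *)
Lemma moebiusK (K : fieldType) (a b c e x : K) :
  c * x + e != 0 -> a * e - b * c != 0 ->
  (e * ((a * x + b) / (c * x + e)) - b) / (- c * ((a * x + b) / (c * x + e)) + a) = x.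
Proof.
move=> D0 det0; field; rewrite D0 /=.
by rewrite [X in X != 0](_ : _ = a * e - b * c) //; ring.
Qed.

(** * Equivalence, up to birational maps, of an n-form together with functions *)

Section Equivalence.
Variables (F : fieldType) (n : nat).
Local Notation L := (ratfun F n).
Implicit Types (f g : L) (m : 'I_n -> L) (i j : 'I_n).

Lemma pullM m : dominant m -> {morph pull m : f g / f * g}.
Proof. by move=> dm; exact: (rmorphM (pull_rmorphism dm)). Qed.

Lemma pullN m : dominant m -> {morph pull m : f / - f}.
Proof. by move=> dm; exact: (rmorphN (pull_rmorphism dm)). Qed.

Lemma jacobian_det_eq m m' : m =1 m' -> \det (jacobian m) = \det (jacobian m').
Proof. by move=> E; congr (\det _); apply/matrixP=> i j; rewrite !mxE E. Qed.

Lemma pull_formE m h : pull_form m h = pull m h * \det (jacobian m).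
Proof. by []. Qed.

Lemma birational_comp m m' : birational m -> birational m' ->
  birational (fun i => pull m (m' i)).
Proof.
move=> [dm [im [dim mK imK]]] [dm' [im' [dim' mK' imK']]].
split; first exact: dominant_comp.
exists (fun i => pull im' (im i)); split=> [|i|i]; first exact: dominant_comp.
  rewrite -pull_comp // [pull m' _]pull_comp //.
  by rewrite (eq_pull mK') pull_id mK.
rewrite -pull_comp // [pull im _]pull_comp //.
by rewrite (eq_pull imK) pull_id imK'.
Qed.

(* The tuple d stands for the n-form d_0 dX_0 /\ ... /\ dX_(n-1) together with
   the functions d_i for i != 0. *)
Definition form_equiv r (d d' : 'I_r.+1 -> L) : Prop :=
  exists m, [/\ birational m, forall k, k != 0 -> pull m (d' k) = d k &
    pull_form m (d' 0) = d 0 \/ pull_form m (d' 0) = - d 0].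

(** The inverse map works: the chain rule applied to the identity makes the two Jacobian
    determinants inverse to each other after pull-back. *)
Lemma form_equiv_sym r (d d' : 'I_r.+1 -> L) :
  form_equiv d d' -> form_equiv d' d.
Proof.
move=> [m [[dm [im [dim mK imK]]] Ed Ew]].
have K' f : pull im (pull m f) = f.
  by rewrite pull_comp // (eq_pull imK) pull_id.
exists im; split=> [|i i0|]; first by split=> //; exists m.
  by rewrite -Ed // K'.
have J1 : pull im (\det (jacobian m)) * \det (jacobian im) = 1.
  by rewrite -det_jacobian_comp // (jacobian_det_eq imK) jacobian_rvar det1.
have E : pull_form im (pull_form m (d' 0)) = d' 0.
  rewrite !pull_formE pullM // K'.
  by rewrite -mulrA J1 mulr1.
case: Ew => Ew; [left|right]; first by rewrite -Ew E.
have -> : d 0 = - pull_form m (d' 0) by rewrite Ew opprK.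
by rewrite pull_formE pullN // mulNr -[X in - X]/(pull_form im _) E.
Qed.

(** Multiplicativity of Jacobian determinants makes the pull-back of forms functorial, and the two
    signs multiply. *)
Lemma form_equiv_trans r (d1 d2 d3 : 'I_r.+1 -> L) :
  form_equiv d1 d2 -> form_equiv d2 d3 -> form_equiv d1 d3.
Proof.
move=> [m [bm Ed Ew]] [m' [bm' Ed' Ew']].
have [dm _] := bm; have [dm' _] := bm'.
exists (fun i => pull m (m' i)); split=> [|i i0|]; first exact: birational_comp.
  by rewrite -pull_comp // Ed' // Ed.
have E : pull_form (fun i => pull m (m' i)) (d3 0) =
    pull_form m (pull_form m' (d3 0)).
  by rewrite !pull_formE det_jacobian_comp // -pull_comp // pullM // mulrA.
have N h : pull_form m (- h) = - pull_form m h.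
  by rewrite !pull_formE pullN // mulNr.
rewrite E; case: Ew' => ->; rewrite ?N; case: Ew => ->; rewrite ?opprK; by [left|right].
Qed.

(* f does not involve the variable X_i: all that is used of this is that f is
   constant along X_i and is fixed by every map moving only X_i. *)
Definition indep i f : Prop :=
  rderiv i f = 0 /\
  forall m, dominant m -> (forall j, j != i -> m j = rvar F j) -> pull m f = f.

Section Indep.
Variable i : 'I_n.

Lemma indep_rcst c : indep i (rcst n c).
Proof. by split=> [|m dm _]; rewrite ?rderivC ?pull_rcst. Qed.

Lemma indep1 : indep i 1.
Proof. by rewrite -[1](rmorph1 (@rcst F n)); apply: indep_rcst. Qed.

Lemma indep0 : indep i 0.
Proof. by rewrite -[0](rmorph0 (@rcst F n)); apply: indep_rcst. Qed.

Lemma indep_rvar j : j != i -> indep i (rvar F j).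
Proof.
move=> ne; split=> [|m dm E]; first by rewrite rderivX eq_sym (negPf ne).
by rewrite pull_rvar // E.
Qed.

Lemma indepD f g : indep i f -> indep i g -> indep i (f + g).
Proof.
move=> [df pf] [dg pg]; split=> [|m dm E]; first by rewrite rderivD df dg addr0.
by rewrite -[LHS]/(pull_rmorphism dm _) rmorphD /= pf ?pg.
Qed.

Lemma indepN f : indep i f -> indep i (- f).
Proof.
move=> [df pf]; split=> [|m dm E]; first by rewrite rderivN df oppr0.
by rewrite pullN // pf.
Qed.

Lemma indepM f g : indep i f -> indep i g -> indep i (f * g).
Proof.
move=> [df pf] [dg pg]; split=> [|m dm E].
  by rewrite rderivM df dg mul0r mulr0 addr0.
by rewrite pullM // pf ?pg.
Qed.

Lemma indepV f : indep i f -> indep i f^-1.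
Proof.
move=> [df pf]; split=> [|m dm E].
  have [->|f0] := eqVneq f 0; first by rewrite invr0 rderiv0.
  by rewrite rderivV // df oppr0 mul0r.
by rewrite -[LHS]/(pull_rmorphism dm _) fmorphV /= pf.
Qed.

Lemma indepX f e : indep i f -> indep i (f ^+ e).
Proof.
by move=> Hf; elim: e => [|e IH]; rewrite ?exprS; [apply: indep1|apply: indepM].
Qed.

Lemma rderiv_indep_lin a b : indep i a -> indep i b ->
  rderiv i (a * rvar F i + b) = a.
Proof.
move=> [da _] [db _]; rewrite rderivD rderivM da db rderivX eqxx.
by rewrite mul0r add0r addr0 mulr1.
Qed.

(** If the expression vanished, so would its derivative [a] along X_i, and then [b]. This is the
    main tool for showing that denominators are nonzero. *)
Lemma indep_lin_neq0 a b : indep i a -> indep i b ->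
  (a != 0) || (b != 0) -> a * rvar F i + b != 0.
Proof.
move=> ia ib; apply: contraL => /eqP E.
have a0 : a = 0 by rewrite -(rderiv_indep_lin ia ib) E rderiv0.
by move: E; rewrite a0 mul0r add0r => ->; rewrite eqxx.
Qed.

Lemma rvar_sub_neq0 b : indep i b -> rvar F i - b != 0.
Proof.
move=> ib; rewrite -[rvar F i]mul1r; apply: indep_lin_neq0; first exact: indep1.
  exact: indepN.
by rewrite oner_eq0.
Qed.

Lemma rvar_neq0 : rvar F i != 0 :> L.
Proof. by rewrite -[rvar F i]subr0; apply: rvar_sub_neq0; apply: indep0. Qed.

(** Two differentiations along X_i leave 2a, which is nonzero in characteristic 0. *)
Lemma indep_quad_neq0 a b c : [pchar F] =i pred0 ->
  indep i a -> indep i b -> indep i c -> a != 0 ->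
  a * rvar F i ^+ 2 + b * rvar F i + c != 0.
Proof.
move=> ch0 ia ib ic; apply: contraNneq => E.
have : rderiv i (a * rvar F i ^+ 2 + b * rvar F i + c) = 0 by rewrite E rderiv0.
rewrite -addrA rderivD (rderiv_indep_lin ib ic) rderivM ia.1 mul0r add0r.
rewrite expr2 rderivM rderivX eqxx mulr1 mul1r => /(congr1 (rderiv i)).
rewrite rderiv0 mulrDr -mulrDl (rderiv_indep_lin (indepD ia ia) ib).
have two : 2%:R != 0 :> L.
  by rewrite -(rmorph_nat (@rcst F n)) fmorph_eq0; have /pcharf0P -> := ch0.
by move/eqP; rewrite -mulr2n -mulr_natr mulf_eq0 (negPf two) orbF.
Qed.

End Indep.

(** * Birational maps moving one coordinate by a Moebius transformation *)

Section Moebius.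
Variables (i : 'I_n) (a b c e : L).
Hypotheses (ch0 : [pchar F] =i pred0).

Definition moebius (a b c e : L) : 'I_n -> L := fun j =>
  if j == i then (a * rvar F i + b) / (c * rvar F i + e) else rvar F j.

Hypotheses (ia : indep i a) (ib : indep i b) (ic : indep i c) (ie : indep i e).
Hypothesis det0 : a * e - b * c != 0.

Lemma moebius_denom_neq0 : c * rvar F i + e != 0.
Proof.
apply: indep_lin_neq0 => //; rewrite -negb_and; apply: contraNN det0.
by case/andP=> /eqP -> /eqP ->; rewrite !mulr0 subrr.
Qed.

Lemma det_jacobian_moebius : \det (jacobian (moebius a b c e)) =
  (a * e - b * c) / (c * rvar F i + e) ^+ 2.
Proof.
have D0 := moebius_denom_neq0.
set A := jacobian _.
(* The Jacobian matrix differs from the identity only in row i, and cofactors along that row do not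
   see it. *)
have cof j : cofactor A i j = (i == j)%:R.
  have : (\adj (1%:M : 'M[L]_n)) j i = (i == j)%:R.
    by rewrite -[\adj _]mul1mx mul_mx_adj det1 !mxE eq_sym.
  rewrite mxE => <-; congr (_ * \det _); apply/matrixP=> k l.
  rewrite !mxE /moebius [lift i k == i]eq_sym (negPf (neq_lift i k)).
  by rewrite rderivX eq_sym.
rewrite (expand_det_row A i) (bigD1 i) //= big1 => [|j ne]; last first.
  by rewrite cof eq_sym (negPf ne) mulr0.
rewrite cof eqxx mulr1 addr0 mxE /moebius eqxx.
by rewrite rderivM rderivV // !rderiv_indep_lin // moebius_deriv.
Qed.

Lemma dominant_moebius : dominant (moebius a b c e).
Proof.
apply: (dominant_det ch0).
rewrite det_jacobian_moebius.
apply: mulf_neq0; first exact: det0.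
exact: (invr_neq0 (expf_neq0 2 moebius_denom_neq0)).
Qed.

End Moebius.

(** The coefficients do not involve X_i, so the map fixes them and only the one-variable inversion
    [moebiusK] remains. *)
Lemma moebius_inv i a b c e : [pchar F] =i pred0 ->
  indep i a -> indep i b -> indep i c -> indep i e -> a * e - b * c != 0 ->
  forall j, pull (moebius i a b c e) (moebius i e (- b) (- c) a j) = rvar F j.
Proof.
move=> ch0 ia ib ic ie det0 j.
have dm := dominant_moebius ch0 ia ib ic ie det0.
have fix_ k : k != i -> moebius i a b c e k = rvar F k.
  by rewrite /moebius => /negPf ->.
rewrite {2}/moebius; case: eqP => [->|/eqP ne]; last by rewrite pull_rvar // fix_.
rewrite -[LHS]/(pull_rmorphism dm _) fmorph_div !rmorphD !rmorphM !rmorphN /=.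
rewrite (proj2 ia) // (proj2 ib) // (proj2 ic) // (proj2 ie) // pull_rvar //.
rewrite /moebius eqxx.
exact: (moebiusK (moebius_denom_neq0 ic ie det0) det0).
Qed.

Lemma birational_moebius i a b c e : [pchar F] =i pred0 ->
  indep i a -> indep i b -> indep i c -> indep i e -> a * e - b * c != 0 ->
  birational (moebius i a b c e).
Proof.
move=> ch0 ia ib ic ie det0.
have [ib' ic'] := (indepN ib, indepN ic).
have det0' : e * a - - b * - c != 0 by rewrite mulrNN mulrC.
split; first exact: (dominant_moebius ch0 ia ib ic ie det0).
exists (moebius i e (- b) (- c) a); split.
- exact: (dominant_moebius ch0 ie ib' ic' ia det0').
- exact: (moebius_inv ch0 ia ib ic ie det0).
by move=> j; have := moebius_inv ch0 ie ib' ic' ia det0' j; rewrite !opprK.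
Qed.

(** The data are checked for an arbitrary field morphism with the prescribed values on constants and
    variables, so each use is pure morphism rewriting, without unfolding [pull]. *)
Lemma form_equiv_moebius i a b c e r (d d' : 'I_r.+1 -> L) :
  [pchar F] =i pred0 ->
  indep i a -> indep i b -> indep i c -> indep i e -> a * e - b * c != 0 ->
  (forall phi : {rmorphism L -> L},
     (forall x, phi (rcst n x) = rcst n x) ->
     (forall j, j != i -> phi (rvar F j) = rvar F j) ->
     phi (rvar F i) = (a * rvar F i + b) / (c * rvar F i + e) ->
     (forall k, k != 0 -> phi (d' k) = d k) /\
     let w := phi (d' 0) * ((a * e - b * c) / (c * rvar F i + e) ^+ 2) in
     w = d 0 \/ w = - d 0) ->
  form_equiv d d'.
Proof.
move=> ch0 ia ib ic ie det0 H.
have dm := dominant_moebius ch0 ia ib ic ie det0.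
have [|j ne||Ed Ew] := H (pull_rmorphism dm).
- exact: pull_rcst.
- by rewrite /= pull_rvar // /moebius (negPf ne).
- by rewrite /= pull_rvar // /moebius eqxx.
exists (moebius i a b c e); split=> //.
  exact: (birational_moebius ch0 ia ib ic ie det0).
by rewrite pull_formE (det_jacobian_moebius ia ib ic ie det0).
Qed.

End Equivalence.

(** * The form and the functions in the successive charts *)

Section Formulas.
Variables (K : fieldType) (t U V U' V' : K).

(** Each [w] is a form coefficient freed of the powers of A, B, C and f4, each [A] belongs to s1 and
    each [f] to r; indices increase along the chain of charts. *)
Definition w0 y : K := (y ^+ 2 * (y - 1) * (y - t))^-1.
Definition w1 y q1 : K := (y ^+ 2 * q1 * (y - t))^-1.
Definition w2 y q1 q2 : K := (y ^+ 2 * q1 * q2)^-1.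

Definition A0 y q1 q2 q3 q4 : K := (1 - q1 - q2) * (1 - q3 - q4) / y.
Definition f0 y q1 q2 q3 q4 : K :=
  (1 + V * (y - t) / q2 + U * (y - 1) / q1) *
  (1 + V' * (y - t) / q4 + U' * (y - 1) / q3) /
  ((1 - q1 - q2) * (1 - q3 - q4)).

Definition f2 y q1 q2 B C : K :=
  (1 + V * (y - t) / q2 + U * (y - 1) / q1) *
  (1 + V' * q2 / C + U' * q1 / B) /
  ((1 - q1 - q2) * (1 - B * (y - 1) / q1 - C * (y - t) / q2)).
Definition A2 y q1 q2 B C : K :=
  (1 - q1 - q2) * (1 - B * (y - 1) / q1 - C * (y - t) / q2) / y.

Definition delta B C : K := U * C - V * B.

(** This is q1 q2 (1 + B/q1 + t C/q2); the bracket times -(1 - q1 - q2) is the determinant of the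
    Moebius change from y to A. *)
Definition den3 q1 q2 B C : K := q1 * q2 + B * q2 + t * C * q1.
Definition w3 q1 q2 B C : K := ((1 - q1 - q2) * den3 q1 q2 B C)^-1.
Definition f3 A q1 q2 B C : K :=
  (1 + V' * q2 / C + U' * q1 / B) *
  (A * (q1 * q2 - U * q2 - t * V * q1) + (1 - q1 - q2) *
    ((U + B) * q2 + (V + C) * q1 + (t - 1) * delta B C)) /
  (A * (1 - q1 - q2) * den3 q1 q2 B C).

(* q1 as a function of s = (U + B) q2 + t (V + C) q1 and q2 *)
Definition q1_of s q2 B C : K := (s - q2 * (U + B)) / (t * (V + C)).

Section Chart4.
Variables (s Y B C : K).
Let X := 1 - t * Y.
Let E := U + B.
Let G := V + C.

Definition num4s : K := Y * E * U' / B + X * G * V' / C.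
Definition num4c : K := E * G * (1 + U * U' / B + t * V * V' / C) -
  V * E ^+ 2 * U' / B - t * U * G ^+ 2 * V' / C.
Definition quo4s : K := - (Y * E + X * G).
Definition quo4c : K := E * G * (1 - U - t * V) + V * E ^+ 2 + t * U * G ^+ 2.
Definition num4 : K := num4s * s + num4c.
Definition quo4 : K := quo4s * s + quo4c.
Definition den4 : K := s * X * Y + t * G * B * Y + E * C * X.
Definition aux4 : K := s * X * Y - V * E * X - t * U * G * Y.
Definition w4 : K := E * G / (quo4 * den4).
Definition f4 A : K :=
  num4 / quo4 * (A * aux4 + quo4 * (X + Y)) / (A * den4).
End Chart4.

(** At (a, b) = (U, V) this is the quadratic factor in eta = [quad] [num4] / [quo4]. *)
Definition quad (a b Y : K) : K :=
  b * (1 - t * Y) ^+ 2 + (t * b + a - 1) * (1 - t * Y) * Y + t * a * Y ^+ 2.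
(** In the last chart the parameters enter only through [sym1], [sym0] and the product of the two
    values of [quad]. *)
Definition sym1 Y B C : K :=
  Y * (U + B) * (U' / B + 1) + (1 - t * Y) * (V + C) * (V' / C + 1) +
  delta B C * (U' / B - V' / C).
Definition sym0 Y B C : K :=
  (1 - t * Y) * (V * V') / C + Y * (U * U') / B + (1 - t * Y) * Y.
Definition den5 eta Y B C : K := quad U V Y * quad U' V' Y +
  eta * ((1 - t * Y) * C + Y * B + (1 - t * Y) * Y).
Definition f5 A eta Y B C : K :=
  - (eta + sym0 Y B C - (1 - t * Y + Y) * sym1 Y B C / A) * eta /
  den5 eta Y B C.

End Formulas.

(** * Rational identities behind the coordinate changes *)

Section FieldIdentities.
Variables (K : fieldType) (t U V U' V' : K).

(** Multiplied by [quad] at (U, V) and divided by [quo4], the left-hand side becomes [den5] at eta;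
    so [den5] contains [den4] and [sym1] as factors. *)
Lemma num4_quo4 s Y B C : B != 0 -> C != 0 ->
  quad t U' V' Y * quo4 t U V s Y B C +
    num4 t U V U' V' s Y B C * ((1 - t * Y) * C + Y * B + (1 - t * Y) * Y) =
  den4 t U V s Y B C * sym1 t U V U' V' Y B C.
Proof.
move=> B0 C0.
rewrite /quad /quo4 /quo4s /quo4c /num4 /num4s /num4c /den4 /sym1 /delta.
by field; rewrite B0 C0.
Qed.

(** Divided by [quo4], the left-hand side is -(eta + [sym0]); this produces the numerator of [f5]
    from that of [f4]. *)
Lemma num4_sym0 s Y B C : B != 0 -> C != 0 ->
  - (quad t U V Y * num4 t U V U' V' s Y B C +
     sym0 t U V U' V' Y B C * quo4 t U V s Y B C) =
  aux4 t U V s Y B C * sym1 t U V U' V' Y B C.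
Proof.
move=> B0 C0.
rewrite /quad /quo4 /quo4s /quo4c /num4 /num4s /num4c /aux4 /sym1 /sym0 /delta.
by field; rewrite B0 C0.
Qed.

(** Up to the factor [quad], this is the determinant of the change from s to eta; its [sym1] cancels
    the one contained in [den5]. *)
Lemma moebius_det5 Y B C : B != 0 -> C != 0 ->
  num4s t U V U' V' Y B C * quo4c t U V B C -
    num4c t U V U' V' B C * quo4s t U V Y B C =
  (U + B) * (V + C) * sym1 t U V U' V' Y B C.
Proof.
move=> B0 C0; rewrite /num4s /num4c /quo4s /quo4c /sym1 /delta.
by field; rewrite B0 C0.
Qed.

Lemma step1_w y q1 : y != 0 -> y - 1 != 0 -> y - t != 0 -> q1 != 0 ->
  w1 t y q1 * (q1 / (y - 1)) = w0 t y.
Proof. by rewrite /w1 /w0; move=> y0 y1 yt q0; field; rewrite y0 y1 yt q0. Qed.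

Lemma step2_w y q1 q2 : y != 0 -> y - t != 0 -> q1 != 0 -> q2 != 0 ->
  w2 y q1 q2 * (q2 / (y - t)) = w1 t y q1.
Proof. by rewrite /w1 /w2; move=> y0 yt q10 q20; field; rewrite y0 yt q10 q20. Qed.

(** With B and C as coordinates, A is Moebius in y; the denominator is written [1 * y + 0] to match
    c = 1 and e = 0. *)
Lemma step3_A y q1 q2 B C : y != 0 -> q1 != 0 -> q2 != 0 ->
  A2 t y q1 q2 B C =
  (- ((1 - q1 - q2) * (B / q1 + C / q2)) * y +
     (1 - q1 - q2) * (1 + B / q1 + t * C / q2)) / (1 * y + 0).
Proof. by move=> y0 q10 q20; rewrite /A2 mul1r addr0; field; rewrite y0 q10 q20. Qed.

Lemma step3_f y q1 q2 B C : y != 0 -> q1 != 0 -> q2 != 0 ->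
  B != 0 -> C != 0 -> 1 - q1 - q2 != 0 ->
  1 - B * (y - 1) / q1 - C * (y - t) / q2 != 0 -> den3 t q1 q2 B C != 0 ->
  f3 t U V U' V' (A2 t y q1 q2 B C) q1 q2 B C = f2 t U V U' V' y q1 q2 B C.
Proof.
rewrite /f3 /f2 /A2; set l := 1 - q1 - q2; set l' := 1 - _ - _.
set g := 1 + V' * q2 / C + _ => y0 q10 q20 B0 C0 l0 l'0; rewrite /den3 => d0.
(* The second factor of the numerator of [f3] is the first factor of [f2] times (1 - q1 - q2) [den3]
   / y, so [den3] cancels. *)
suff E : l * l' / y * (q1 * q2 - U * q2 - t * V * q1) +
   l * ((U + B) * q2 + (V + C) * q1 + (t - 1) * delta U V B C) =
  (1 + V * (y - t) / q2 + U * (y - 1) / q1) *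
  (l * (q1 * q2 + B * q2 + t * C * q1)) / y.
  by rewrite E; field; rewrite y0 q10 q20 l0 l'0 d0.
by rewrite /l' /delta; field; rewrite y0 q10 q20.
Qed.

Lemma step3_w y q1 q2 B C : y != 0 -> q1 != 0 -> q2 != 0 ->
  1 - q1 - q2 != 0 -> den3 t q1 q2 B C != 0 ->
  w3 t q1 q2 B C *
    ((- ((1 - q1 - q2) * (B / q1 + C / q2)) * 0 -
      (1 - q1 - q2) * (1 + B / q1 + t * C / q2) * 1) / (1 * y + 0) ^+ 2) =
  - w2 y q1 q2.
Proof.
rewrite /w3 /w2 mulr0 sub0r mulr1 mul1r addr0.
set l := 1 - _ - _ => y0 q10 q20 l0; rewrite /den3 => d0.
by field; rewrite y0 q10 q20 l0 d0.
Qed.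

Section Chart4.
Variables (A s Y B C : K).
Let X := 1 - t * Y.
Let E := U + B.
Let G := V + C.
Let q1 := U + (s * Y - V * E) / G.
Let q2 := t * V + (s * X - t * U * G) / E.
Hypotheses (t0 : t != 0) (B0 : B != 0) (C0 : C != 0) (E0 : E != 0) (G0 : G != 0).

(** Here q1 and q2 are the old coordinates recovered from s and Y, with E q2 + t G q1 = s. The
    identities from here to [numE] carry each factor of [f3] and [w3] into the new chart. *)
Let lE : 1 - q1 - q2 = quo4 t U V s Y B C / (E * G).
Proof.
rewrite /q1 /q2 /quo4 /quo4s /quo4c -/E -/G -/X.
by field; rewrite E0 G0.
Qed.

Let denE : den3 t q1 q2 B C = s * den4 t U V s Y B C / (E * G).
Proof.
rewrite /q1 /q2 /den3 /den4 -/E -/G -/X; move: E0 G0; rewrite /E /G => E0' G0'.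
by field; rewrite E0' G0'.
Qed.

Let auxE : q1 * q2 - U * q2 - t * V * q1 = s * aux4 t U V s Y B C / (E * G).
Proof. by rewrite /q1 /q2 /aux4 -/E -/G -/X; field; rewrite E0 G0. Qed.

Let linE : (U + B) * q2 + (V + C) * q1 + (t - 1) * delta U V B C = s * (X + Y).
Proof.
rewrite /q1 /q2 /delta; move: E0 G0; rewrite /E /G => E0' G0'.
by field; rewrite E0' G0'.
Qed.

Let numE : 1 + V' * q2 / C + U' * q1 / B = num4 t U V U' V' s Y B C / (E * G).
Proof.
rewrite /q1 /q2 /num4 /num4s /num4c -/E -/G -/X.
by field; rewrite E0 G0 B0 C0.
Qed.

Hypotheses (A0 : A != 0) (s0 : s != 0) (M0 : quo4 t U V s Y B C != 0).
Hypothesis (S0 : den4 t U V s Y B C != 0).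

Lemma chart4_f : f3 t U V U' V' A q1 q2 B C = f4 t U V U' V' s Y B C A.
Proof.
rewrite /f3 /f4 lE denE auxE linE numE -/X.
by field; rewrite A0 s0 M0 S0 E0 G0.
Qed.

Lemma chart4_w :
  w4 t U V s Y B C * (- E / (t * s)) = - (w3 t q1 q2 B C / (t * G)).
Proof.
by rewrite /w3 /w4 lE denE -/E -/G; field; rewrite t0 s0 M0 S0 E0 G0.
Qed.

Let p := quad t U V Y.
Let eta := p * num4 t U V U' V' s Y B C / quo4 t U V s Y B C.
Hypotheses (p0 : p != 0) (g0 : sym1 t U V U' V' Y B C != 0).

Let den5E : den5 t U V U' V' eta Y B C =
  p * (den4 t U V s Y B C * sym1 t U V U' V' Y B C) / quo4 t U V s Y B C.
Proof.
by rewrite -num4_quo4 // /den5 /eta -/p; field.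
Qed.

Lemma chart5_f : f5 t U V U' V' A eta Y B C = f4 t U V U' V' s Y B C A.
Proof.
rewrite /f5 den5E /f4 -/X.
(* [aux4] is traded for [sym0] and [sym1], the only quantities the numerator of [f5] uses besides A,
   eta and Y. *)
have E1 : A * aux4 t U V s Y B C = - A * (p * num4 t U V U' V' s Y B C +
     sym0 t U V U' V' Y B C * quo4 t U V s Y B C) / sym1 t U V U' V' Y B C.
  by rewrite -[RHS]mulrA mulNr -mulrN -mulNr num4_sym0 // mulfK.
by rewrite E1 /eta; field; rewrite A0 M0 S0 p0 g0.
Qed.

Lemma chart5_w : (den5 t U V U' V' eta Y B C)^-1 *
  ((p * num4s t U V U' V' Y B C * quo4c t U V B C -
    p * num4c t U V U' V' B C * quo4s t U V Y B C) / quo4 t U V s Y B C ^+ 2) =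
  w4 t U V s Y B C.
Proof.
rewrite -!mulrA -mulrBr mulrA moebius_det5 // den5E /w4 -/E -/G.
by field; rewrite M0 S0 p0 g0.
Qed.

End Chart4.

Lemma q1_of_q2 s q2 B C : t != 0 -> s != 0 -> V + C != 0 ->
  let Y := (- (U + B) / (t * s)) * q2 + (s - t * delta U V B C) / (t * s) in
  q1_of t U V s q2 B C = U + (s * Y - V * (U + B)) / (V + C).
Proof.
by move=> t0 s0 G0; rewrite /q1_of /delta; field; rewrite t0 s0 G0.
Qed.

Lemma q2_of_Y s q2 B C : t != 0 -> s != 0 -> U + B != 0 ->
  let Y := (- (U + B) / (t * s)) * q2 + (s - t * delta U V B C) / (t * s) in
  q2 = t * V + (s * (1 - t * Y) - t * U * (V + C)) / (U + B).
Proof.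
by move=> t0 s0 E0; rewrite /delta; field; rewrite t0 s0 E0.
Qed.

End FieldIdentities.

(** * Symmetry of the last chart in x2 and x3 *)

Section Symmetry.
Variables (K : fieldType) (t : K).
Hypotheses (t0 : t != 0) (t1 : t - 1 != 0).

Definition uu (a b : K) : K := (a - 1) * (b - 1) / (t - 1) ^+ 2.
Definition vv (a b : K) : K := (a - t) * (b - t) / (t * (t - 1) ^+ 2).

Variables (x1 x2 x3 z Y B C : K).
Hypotheses (B0 : B != 0) (C0 : C != 0).

(** Only U U' and V V' occur, and each is a product with one factor for each of x1, x2, x3, z. *)
Lemma sym0_swap :
  sym0 t (uu x1 x2) (vv x1 x2) (uu x3 z) (vv x3 z) Y B C =
  sym0 t (uu x1 x3) (vv x1 x3) (uu x2 z) (vv x2 z) Y B C.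
Proof. by rewrite /sym0 /uu /vv; field; rewrite t0 t1 B0 C0. Qed.

(** Besides U U' and V V', the expansion involves U + U' - t (V + V'), which is affine in x1 + x2 +
    x3 + z, and V + V' - U V' - U' V, which is -e3/(t (t-1)^3) for e3 the third elementary symmetric
    polynomial of x1 - t, x2 - t, x3 - t, z - t. *)
Lemma sym1_swap :
  sym1 t (uu x1 x2) (vv x1 x2) (uu x3 z) (vv x3 z) Y B C =
  sym1 t (uu x1 x3) (vv x1 x3) (uu x2 z) (vv x2 z) Y B C.
Proof. by rewrite /sym1 /delta /uu /vv; field; rewrite t0 t1 B0 C0. Qed.

(* quad splits into one factor for each x_i, so the product over both pairs is
   symmetric. *)
Lemma quad_factor (a b : K) : quad t (uu a b) (vv a b) Y =
  (a - 1 - (t - 1) * (1 - t * Y)) * (b - 1 - (t - 1) * (1 - t * Y)) /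
  (t * (t - 1) ^+ 2).
Proof. by rewrite /quad /uu /vv; field; rewrite t0 t1. Qed.

Lemma den5_swap eta :
  den5 t (uu x1 x2) (vv x1 x2) (uu x3 z) (vv x3 z) eta Y B C =
  den5 t (uu x1 x3) (vv x1 x3) (uu x2 z) (vv x2 z) eta Y B C.
Proof. by rewrite /den5 !quad_factor; congr (_ + _); field; rewrite t0 t1. Qed.

Lemma f5_swap A eta :
  f5 t (uu x1 x2) (vv x1 x2) (uu x3 z) (vv x3 z) A eta Y B C =
  f5 t (uu x1 x3) (vv x1 x3) (uu x2 z) (vv x2 z) A eta Y B C.
Proof. by rewrite /f5 den5_swap sym0_swap sym1_swap. Qed.

End Symmetry.

(** * Compatibility of the formulas with field morphisms *)

Section Morphism.
Variables (K K' : fieldType) (phi : {rmorphism K -> K'}).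
Variables (t U V U' V' : K).

Let phiE := (rmorphB, rmorphD, rmorphN, rmorphM, fmorphV, rmorphXn, rmorph1).

Lemma fmorph_uu a b : phi (uu t a b) = uu (phi t) (phi a) (phi b).
Proof. by rewrite /uu !phiE. Qed.

Lemma fmorph_vv a b : phi (vv t a b) = vv (phi t) (phi a) (phi b).
Proof. by rewrite /vv !phiE. Qed.

Lemma fmorph_A0 y q1 q2 q3 q4 : phi (A0 y q1 q2 q3 q4) =
  A0 (phi y) (phi q1) (phi q2) (phi q3) (phi q4).
Proof. by rewrite /A0 !phiE. Qed.

Lemma fmorph_f0 y q1 q2 q3 q4 : phi (f0 t U V U' V' y q1 q2 q3 q4) =
  f0 (phi t) (phi U) (phi V) (phi U') (phi V')
    (phi y) (phi q1) (phi q2) (phi q3) (phi q4).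
Proof. by rewrite /f0 !phiE. Qed.

Lemma fmorph_w1 y q1 : phi (w1 t y q1) = w1 (phi t) (phi y) (phi q1).
Proof. by rewrite /w1 !phiE. Qed.

Lemma fmorph_w2 y q1 q2 : phi (w2 y q1 q2) = w2 (phi y) (phi q1) (phi q2).
Proof. by rewrite /w2 !phiE. Qed.

Lemma fmorph_A2 y q1 q2 B C : phi (A2 t y q1 q2 B C) =
  A2 (phi t) (phi y) (phi q1) (phi q2) (phi B) (phi C).
Proof. by rewrite /A2 !phiE. Qed.

Lemma fmorph_f2 y q1 q2 B C : phi (f2 t U V U' V' y q1 q2 B C) =
  f2 (phi t) (phi U) (phi V) (phi U') (phi V')
    (phi y) (phi q1) (phi q2) (phi B) (phi C).
Proof. by rewrite /f2 !phiE. Qed.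

Lemma fmorph_q1_of s q2 B C : phi (q1_of t U V s q2 B C) =
  q1_of (phi t) (phi U) (phi V) (phi s) (phi q2) (phi B) (phi C).
Proof. by rewrite /q1_of !phiE. Qed.

Lemma fmorph_w3 q1 q2 B C : phi (w3 t q1 q2 B C) =
  w3 (phi t) (phi q1) (phi q2) (phi B) (phi C).
Proof. by rewrite /w3 /den3 !phiE. Qed.

Lemma fmorph_f3 A q1 q2 B C : phi (f3 t U V U' V' A q1 q2 B C) =
  f3 (phi t) (phi U) (phi V) (phi U') (phi V')
    (phi A) (phi q1) (phi q2) (phi B) (phi C).
Proof. by rewrite /f3 /delta /den3 !phiE. Qed.

Lemma fmorph_quo4 s Y B C : phi (quo4 t U V s Y B C) =
  quo4 (phi t) (phi U) (phi V) (phi s) (phi Y) (phi B) (phi C).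
Proof. by rewrite /quo4 /quo4s /quo4c !phiE. Qed.

Lemma fmorph_den4 s Y B C : phi (den4 t U V s Y B C) =
  den4 (phi t) (phi U) (phi V) (phi s) (phi Y) (phi B) (phi C).
Proof. by rewrite /den4 !phiE. Qed.

Lemma fmorph_w4 s Y B C : phi (w4 t U V s Y B C) =
  w4 (phi t) (phi U) (phi V) (phi s) (phi Y) (phi B) (phi C).
Proof. by rewrite /w4 /quo4 /quo4s /quo4c /den4 !phiE. Qed.

Lemma fmorph_f4 s Y B C A : phi (f4 t U V U' V' s Y B C A) =
  f4 (phi t) (phi U) (phi V) (phi U') (phi V')
    (phi s) (phi Y) (phi B) (phi C) (phi A).
Proof.
rewrite /f4 /num4 /num4s /num4c /quo4 /quo4s /quo4c /den4 /aux4.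
by rewrite !phiE.
Qed.

Lemma fmorph_den5 eta Y B C : phi (den5 t U V U' V' eta Y B C) =
  den5 (phi t) (phi U) (phi V) (phi U') (phi V') (phi eta) (phi Y) (phi B) (phi C).
Proof. by rewrite /den5 /quad !phiE. Qed.

Lemma fmorph_sym0 Y B C : phi (sym0 t U V U' V' Y B C) =
  sym0 (phi t) (phi U) (phi V) (phi U') (phi V') (phi Y) (phi B) (phi C).
Proof. by rewrite /sym0 !phiE. Qed.

Lemma fmorph_sym1 Y B C : phi (sym1 t U V U' V' Y B C) =
  sym1 (phi t) (phi U) (phi V) (phi U') (phi V') (phi Y) (phi B) (phi C).
Proof. by rewrite /sym1 /delta !phiE. Qed.

Lemma fmorph_f5 A eta Y B C : phi (f5 t U V U' V' A eta Y B C) =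
  f5 (phi t) (phi U) (phi V) (phi U') (phi V')
    (phi A) (phi eta) (phi Y) (phi B) (phi C).
Proof.
rewrite /f5 -fmorph_sym0 -fmorph_sym1 -fmorph_den5.
move: (sym0 _ _ _ _ _ _ _ _) (sym1 _ _ _ _ _ _ _ _) => a b.
by move: (den5 _ _ _ _ _ _ _ _ _) => c; rewrite !phiE. Qed.

End Morphism.

(** * Criteria for a single coordinate change on five data *)

Ltac indep_tac := repeat match goal with
  | |- indep _ (_ + _) => apply: indepD
  | |- indep _ (- _) => apply: indepN
  | |- indep _ (_ ^+ _) => apply: indepX
  | |- indep _ (_ * _) => apply: indepM
  | |- indep _ (_^-1) => apply: indepV
  | |- indep _ 1 => apply: indep1
  | |- indep _ 0 => apply: indep0
  | |- indep _ (rcst _ _) => apply: indep_rcst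
  | |- indep _ (rvar _ _) => apply: indep_rvar; by []
  end.

(** The order is that of [collect]: the form coefficient first, then the functions for s1, s2, s3
    and r. *)
Definition dat (K : fieldType) (w A B C f : K) : 'I_5 -> K :=
  fun j => nth 0 [:: w; A; B; C; f] j.

Section Dat.
Variables (F : fieldType) (n : nat).
Local Notation L := (ratfun F n).
Hypothesis ch0 : [pchar F] =i pred0.

Lemma form_equiv_dat_moebius (i : 'I_n) (a b c e w A B C f w' A' B' C' f' : L) :
  indep i a -> indep i b -> indep i c -> indep i e -> a * e - b * c != 0 ->
  (forall phi : {rmorphism L -> L},
     (forall x, phi (rcst n x) = rcst n x) ->
     (forall j, j != i -> phi (rvar F j) = rvar F j) ->
     phi (rvar F i) = (a * rvar F i + b) / (c * rvar F i + e) ->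
     [/\ phi A' = A, phi B' = B, phi C' = C & phi f' = f] /\
     let w1 := phi w' * ((a * e - b * c) / (c * rvar F i + e) ^+ 2) in
     w1 = w \/ w1 = - w) ->
  form_equiv (dat w A B C f) (dat w' A' B' C' f').
Proof.
move=> ia ib ic ie det0 H.
apply: (form_equiv_moebius ch0 ia ib ic ie det0) => phi H1 H2 H3.
have [[EA EB EC Ef] Ew] := H phi H1 H2 H3.
by split=> //; case=> [[|[|[|[|[|k]]]]]].
Qed.

Lemma form_equiv_dat_affine (i : 'I_n) (a b w A B C f w' A' B' C' f' : L) :
  indep i a -> indep i b -> a != 0 ->
  (forall phi : {rmorphism L -> L},
     (forall x, phi (rcst n x) = rcst n x) ->
     (forall j, j != i -> phi (rvar F j) = rvar F j) ->
     phi (rvar F i) = a * rvar F i + b ->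
     [/\ phi A' = A, phi B' = B, phi C' = C & phi f' = f] /\
     (phi w' * a = w \/ phi w' * a = - w)) ->
  form_equiv (dat w A B C f) (dat w' A' B' C' f').
Proof.
move=> ia ib a0 H.
apply: (form_equiv_dat_moebius (i := i) ia ib (indep0 F i) (indep1 F i)).
  by rewrite mulr1 mulr0 subr0.
move=> phi H1 H2; rewrite mul0r add0r expr1n !divr1 mulr1 mulr0 subr0.
exact: H.
Qed.

End Dat.

(** * Identities for the single steps and for nonvanishing *)

Section StepIdentities.
Variables (K : fieldType) (t U V U' V' : K).

Lemma divff_cancel (a b x : K) : a != 0 -> b != 0 -> a / b * x * b / a = x.
Proof. by move=> a0 b0; field; rewrite a0 b0. Qed.

Lemma step2_A y q1 q2 B q4 : q1 != 0 -> q2 != 0 -> y - t != 0 ->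
  A2 t y q1 q2 B (q2 / (y - t) * q4) = A0 y q1 q2 (B * (y - 1) / q1) q4.
Proof.
move=> q10 q20 yt; rewrite /A2 /A0; congr (_ * _ / _).
by field; rewrite q10 q20 yt.
Qed.

Lemma step2_f y q1 q2 B q4 : q1 != 0 -> q2 != 0 -> y - 1 != 0 -> y - t != 0 ->
  B != 0 -> q4 != 0 ->
  f2 t U V U' V' y q1 q2 B (q2 / (y - t) * q4) =
  f0 t U V U' V' y q1 q2 (B * (y - 1) / q1) q4.
Proof.
move=> q10 q20 y1 yt B0 q40; rewrite /f2 /f0; congr (_ * _ / (_ * _)).
  by field; rewrite q10 q20 y1 yt B0 q40.
by field; rewrite q10 q20 yt.
Qed.

Lemma q1_ofK q1 q2 B C : t != 0 -> V + C != 0 ->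
  q1_of t U V (t * (V + C) * q1 + q2 * (U + B)) q2 B C = q1.
Proof. by move=> t0 G0; rewrite /q1_of; field; rewrite t0 G0. Qed.

(** This and the other [_lin] lemmas present an expression as affine in one variable, so that it is
    nonzero once its slope is. *)
Lemma l34_lin y q1 q2 B C :
  1 - B * (y - 1) / q1 - C * (y - t) / q2 =
  - ((y - t) / q2) * C + (1 - B * (y - 1) / q1).
Proof. by ring. Qed.

Lemma den3_lin q1 q2 B C : den3 t q1 q2 B C = q2 * B + (q1 * q2 + t * C * q1).
Proof. by rewrite /den3; ring. Qed.

Lemma step3_det_lin q1 q2 B C :
  1 + B / q1 + t * C / q2 = q1^-1 * B + (1 + t * C / q2).
Proof. by ring. Qed.

Lemma den4_lin s Y B C : den4 t U V s Y B C =
  ((1 - t * Y) * Y) * s + (t * (V + C) * B * Y + (U + B) * C * (1 - t * Y)).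
Proof. by rewrite /den4; ring. Qed.

Lemma quo4s_lin Y B C : quo4s t U V Y B C =
  - (1 - t * Y) * C - (Y * (U + B) + (1 - t * Y) * V).
Proof. by rewrite /quo4s; ring. Qed.

Lemma quad_quad Y : quad t U V Y = t * Y ^+ 2 + (U - 1 - t * V) * Y + V.
Proof. by rewrite /quad; ring. Qed.

Definition sym1_slope B C : K :=
  (U + B) * (U' / B + 1) - t * ((V + C) * (V' / C + 1)).

Lemma sym1_lin Y B C : sym1 t U V U' V' Y B C = sym1_slope B C * Y +
  ((V + C) * (V' / C + 1) + delta U V B C * (U' / B - V' / C)).
Proof. by rewrite /sym1 /sym1_slope; ring. Qed.

(** Multiplication by B gives a monic quadratic in B, which shows that the slope is nonzero. *)
Lemma sym1_slope_quad B C : B != 0 -> sym1_slope B C * B =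
  1 * B ^+ 2 + (U + U' - t * ((V + C) * (V' / C + 1))) * B + U * U'.
Proof.
rewrite /sym1_slope; move: (t * _) => x B0.
by field.
Qed.

Lemma moebius_step6 p s Y B C :
  (p * num4s t U V U' V' Y B C * s + p * num4c t U V U' V' B C) /
    (quo4s t U V Y B C * s + quo4c t U V B C) =
  p * num4 t U V U' V' s Y B C / quo4 t U V s Y B C.
Proof. by rewrite /num4 /quo4 -(mulrA p) -mulrDr. Qed.

End StepIdentities.

(** * The six coordinate changes *)

Section Steps.
Variables (F : fieldType) (t0 U0 V0 U'0 V'0 : F).
Hypothesis ch0 : [pchar F] =i pred0.
Hypothesis t_neq0 : t0 != 0.
Local Notation L := (ratfun F 5).
Let t : L := rcst 5 t0.
Let U : L := rcst 5 U0.
Let V : L := rcst 5 V0.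
Let U' : L := rcst 5 U'0.
Let V' : L := rcst 5 V'0.
Local Notation X0 := (rvar F (0 : 'I_5)).
Local Notation X1 := (rvar F (1 : 'I_5)).
Local Notation X2 := (rvar F (2 : 'I_5)).
Local Notation X3 := (rvar F (3 : 'I_5)).
Local Notation X4 := (rvar F (4 : 'I_5)).

Let lin_neq0 i (a b : L) : indep i a -> indep i b -> a != 0 -> a * rvar F i + b != 0.
Proof. by move=> ia ib a0; apply: indep_lin_neq0 => //; rewrite a0. Qed.

Let y1_neq0 : X0 - 1 != 0.
Proof. by apply: rvar_sub_neq0; indep_tac. Qed.

Let yt_neq0 : X0 - t != 0.
Proof. by apply: rvar_sub_neq0; rewrite /t; indep_tac. Qed.

Let tL_neq0 : t != 0.
Proof. by rewrite fmorph_eq0. Qed.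

Let l_neq0 : 1 - X1 - X2 != 0.
Proof. by rewrite -opprB oppr_eq0; apply: rvar_sub_neq0; indep_tac. Qed.

Let l34_neq0 : 1 - X3 * (X0 - 1) / X1 - X4 * (X0 - t) / X2 != 0.
Proof.
rewrite l34_lin; apply: lin_neq0; rewrite /t; indep_tac.
rewrite oppr_eq0; exact: (mulf_neq0 yt_neq0 (invr_neq0 (rvar_neq0 F 2))).
Qed.

Let den3_neq0 : den3 t X1 X2 X3 X4 != 0.
Proof.
rewrite den3_lin; apply: lin_neq0; rewrite /t; indep_tac.
exact: rvar_neq0.
Qed.

Let det3_neq0 : 1 + X3 / X1 + t * X4 / X2 != 0.
Proof.
rewrite step3_det_lin; apply: lin_neq0; rewrite /t; indep_tac.
exact: (invr_neq0 (rvar_neq0 F 1)).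
Qed.

Let E_neq0 : U + X3 != 0.
Proof. by rewrite addrC -[U]opprK; apply: rvar_sub_neq0; rewrite /U; indep_tac. Qed.

Let G_neq0 : V + X4 != 0.
Proof. by rewrite addrC -[V]opprK; apply: rvar_sub_neq0; rewrite /V; indep_tac. Qed.

Let X_neq0 : 1 - t * X2 != 0.
Proof.
rewrite addrC -mulNr; apply: lin_neq0; rewrite /t; indep_tac.
rewrite oppr_eq0; exact: tL_neq0.
Qed.

Let quo4s_neq0 : quo4s t U V X2 X3 X4 != 0.
Proof.
rewrite quo4s_lin; apply: lin_neq0; rewrite /t /U /V; indep_tac.
rewrite oppr_eq0; exact: X_neq0.
Qed.

Let quo4_neq0 : quo4 t U V X1 X2 X3 X4 != 0.
Proof.
apply: lin_neq0 quo4s_neq0; rewrite /quo4s /quo4c /t /U /V; indep_tac.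
Qed.

Let den4_neq0 : den4 t U V X1 X2 X3 X4 != 0.
Proof.
rewrite den4_lin; apply: lin_neq0; rewrite /t /U /V; indep_tac.
exact: (mulf_neq0 X_neq0 (rvar_neq0 F 2)).
Qed.

Let quad_neq0 : quad t U V X2 != 0.
Proof.
rewrite quad_quad; apply: (indep_quad_neq0 ch0 _ _ _ tL_neq0);
  rewrite /t /U /V; indep_tac.
Qed.

Let sym1_neq0 : sym1 t U V U' V' X2 X3 X4 != 0.
Proof.
rewrite sym1_lin; apply: lin_neq0;
  rewrite ?/sym1_slope ?/delta ?/t ?/U ?/V ?/U' ?/V'; indep_tac.
rewrite -/t -/U -/V -/U' -/V' -[X in X != 0]/(sym1_slope t U V U' V' X3 X4).
suff : sym1_slope t U V U' V' X3 X4 * X3 != 0.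
  by apply: contraNneq => ->; rewrite mul0r.
rewrite (sym1_slope_quad _ _ _ _ _ _ (rvar_neq0 F 3)).
apply: (indep_quad_neq0 ch0); rewrite ?/t ?/U ?/V ?/U' ?/V'; indep_tac.
exact: oner_neq0.
Qed.

(** The variables keep their names while their meaning changes: X3 is B from [data1] on, X4 is C
    from [data2], X0 is A from [data3], X1 is s in [data4] and [data5] and eta in [data6], X2 is Y
    from [data5]. *)
Definition data0 := dat (w0 t X0)
  (A0 X0 X1 X2 X3 X4) (X1 * X3 / (X0 - 1)) (X2 * X4 / (X0 - t))
  (f0 t U V U' V' X0 X1 X2 X3 X4).

Let Z3 : L := X3 * (X0 - 1) / X1.
Definition data1 := dat (w1 t X0 X1)
  (A0 X0 X1 X2 Z3 X4) X3 (X2 * X4 / (X0 - t))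
  (f0 t U V U' V' X0 X1 X2 Z3 X4).

Definition data2 := dat (w2 X0 X1 X2)
  (A2 t X0 X1 X2 X3 X4) X3 X4 (f2 t U V U' V' X0 X1 X2 X3 X4).

Definition data3 := dat (w3 t X1 X2 X3 X4)
  X0 X3 X4 (f3 t U V U' V' X0 X1 X2 X3 X4).

Let Z1 : L := q1_of t U V X1 X2 X3 X4.
(** The form coefficient is divided by t (V + C), the slope of s as a function of q1. *)
Definition data4 := dat (w3 t Z1 X2 X3 X4 / (t * (V + X4)))
  X0 X3 X4 (f3 t U V U' V' X0 Z1 X2 X3 X4).

Definition data5 := dat (w4 t U V X1 X2 X3 X4)
  X0 X3 X4 (f4 t U V U' V' X1 X2 X3 X4 X0).

Definition data6 := dat (den5 t U V U' V' X1 X2 X3 X4)^-1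
  X0 X3 X4 (f5 t U V U' V' X0 X1 X2 X3 X4).

Lemma form_equiv_data01 : form_equiv data0 data1.
Proof.
apply: (form_equiv_dat_affine ch0 (i := 3) (a := X1 / (X0 - 1)) (b := 0)).
- by indep_tac.
- by indep_tac.
- exact: (mulf_neq0 (rvar_neq0 F 1) (invr_neq0 y1_neq0)).
move=> phi phiC phiX; rewrite addr0 => phi3.
have phi0 : phi X0 = X0 by exact: phiX.
have phi1 : phi X1 = X1 by exact: phiX.
have phi2 : phi X2 = X2 by exact: phiX.
have phi4 : phi X4 = X4 by exact: phiX.
have EZ : phi Z3 = X3.
  rewrite /Z3 fmorph_div rmorphM rmorphB rmorph1 phi0 phi1 phi3.
  exact: (divff_cancel X3 (rvar_neq0 F 1) y1_neq0).
split.
  split.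
  - by rewrite fmorph_A0 EZ phi0 phi1 phi2 phi4.
  - by rewrite phi3 mulrAC.
  - by rewrite fmorph_div rmorphM rmorphB phi0 phi2 phi4 phiC.
  - by rewrite fmorph_f0 EZ phi0 phi1 phi2 phi4 !phiC.
left; rewrite fmorph_w1 phi0 phi1 phiC.
exact: (step1_w (rvar_neq0 F 0) y1_neq0 yt_neq0 (rvar_neq0 F 1)).
Qed.

Lemma form_equiv_data12 : form_equiv data1 data2.
Proof.
apply: (form_equiv_dat_affine ch0 (i := 4) (a := X2 / (X0 - t)) (b := 0)).
- by rewrite /t; indep_tac.
- by indep_tac.
- exact: (mulf_neq0 (rvar_neq0 F 2) (invr_neq0 yt_neq0)).
move=> phi phiC phiX; rewrite addr0 => phi4.
have phi0 : phi X0 = X0 by exact: phiX.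
have phi1 : phi X1 = X1 by exact: phiX.
have phi2 : phi X2 = X2 by exact: phiX.
have phi3 : phi X3 = X3 by exact: phiX.
split.
  split.
  - rewrite fmorph_A2 phi0 phi1 phi2 phi3 phi4 phiC.
    exact: (step2_A _ _ (rvar_neq0 F 1) (rvar_neq0 F 2) yt_neq0).
  - exact: phi3.
  - by rewrite phi4 mulrAC.
  - rewrite fmorph_f2 phi0 phi1 phi2 phi3 phi4 !phiC.
    exact: (step2_f _ _ _ _ (rvar_neq0 F 1) (rvar_neq0 F 2) y1_neq0 yt_neq0
      (rvar_neq0 F 3) (rvar_neq0 F 4)).
left; rewrite fmorph_w2 phi0 phi1 phi2.
exact: (step2_w (rvar_neq0 F 0) yt_neq0 (rvar_neq0 F 1) (rvar_neq0 F 2)).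
Qed.

Lemma form_equiv_data23 : form_equiv data2 data3.
Proof.
apply: (form_equiv_dat_moebius ch0 (i := 0)
  (a := - ((1 - X1 - X2) * (X3 / X1 + X4 / X2)))
  (b := (1 - X1 - X2) * (1 + X3 / X1 + t * X4 / X2)) (c := 1) (e := 0)).
- by indep_tac.
- by rewrite /t; indep_tac.
- by indep_tac.
- by indep_tac.
- rewrite mulr0 sub0r mulr1 oppr_eq0.
  exact: (mulf_neq0 l_neq0 det3_neq0).
move=> phi phiC phiX.
rewrite -(step3_A _ _ _ (rvar_neq0 F 0) (rvar_neq0 F 1) (rvar_neq0 F 2)) => phi0.
have phi1 : phi X1 = X1 by exact: phiX.
have phi2 : phi X2 = X2 by exact: phiX.
have phi3 : phi X3 = X3 by exact: phiX.
have phi4 : phi X4 = X4 by exact: phiX.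
split.
  split=> //.
  rewrite fmorph_f3 phi0 phi1 phi2 phi3 phi4 !phiC.
  exact: (step3_f _ _ _ _ (rvar_neq0 F 0) (rvar_neq0 F 1) (rvar_neq0 F 2)
    (rvar_neq0 F 3) (rvar_neq0 F 4) l_neq0 l34_neq0 den3_neq0).
right; rewrite fmorph_w3 phi1 phi2 phi3 phi4 phiC.
exact: (step3_w (rvar_neq0 F 0) (rvar_neq0 F 1) (rvar_neq0 F 2) l_neq0 den3_neq0).
Qed.

Lemma form_equiv_data34 : form_equiv data3 data4.
Proof.
apply: (form_equiv_dat_affine ch0 (i := 1)
  (a := t * (V + X4)) (b := X2 * (U + X3))).
- by rewrite /t /V; indep_tac.
- by rewrite /U; indep_tac.
- exact: (mulf_neq0 tL_neq0 G_neq0).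
move=> phi phiC phiX phi1.
have phi0 : phi X0 = X0 by exact: phiX.
have phi2 : phi X2 = X2 by exact: phiX.
have phi3 : phi X3 = X3 by exact: phiX.
have phi4 : phi X4 = X4 by exact: phiX.
have EZ : phi Z1 = X1.
  rewrite fmorph_q1_of phi1 phi2 phi3 phi4 !phiC.
  exact: (q1_ofK _ _ _ _ tL_neq0 G_neq0).
split.
  split=> //.
  by rewrite fmorph_f3 EZ phi0 phi2 phi3 phi4 !phiC.
left; rewrite fmorph_div fmorph_w3 EZ phi2 phi3 phi4 rmorphM rmorphD phi4 !phiC.
exact: (divfK (mulf_neq0 tL_neq0 G_neq0)).
Qed.

Lemma form_equiv_data45 : form_equiv data4 data5.
Proof.
apply: (form_equiv_dat_affine ch0 (i := 2)
  (a := - (U + X3) / (t * X1)) (b := (X1 - t * delta U V X3 X4) / (t * X1))).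
- by rewrite /t /U; indep_tac.
- by rewrite /delta /t /U /V; indep_tac.
- apply: mulf_neq0; first by rewrite oppr_eq0; exact: E_neq0.
  exact: (invr_neq0 (mulf_neq0 tL_neq0 (rvar_neq0 F 1))).
move=> phi phiC phiX phi2.
have phi0 : phi X0 = X0 by exact: phiX.
have phi1 : phi X1 = X1 by exact: phiX.
have phi3 : phi X3 = X3 by exact: phiX.
have phi4 : phi X4 = X4 by exact: phiX.
(* A field morphism is injective, so nonvanishing in the target chart carries over to the source,
   where [phi X2] is Y expressed through q2. *)
have M0 : quo4 t U V X1 (phi X2) X3 X4 != 0.
  by have := quo4_neq0; rewrite -(fmorph_eq0 phi) fmorph_quo4 phi1 phi3 phi4 !phiC.
have S0 : den4 t U V X1 (phi X2) X3 X4 != 0.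
  by have := den4_neq0; rewrite -(fmorph_eq0 phi) fmorph_den4 phi1 phi3 phi4 !phiC.
(* [E1] and [E2] rewrite q1 and q2 in terms of s and Y, the shape required by [chart4_f] and
   [chart4_w]. *)
have E1 := q1_of_q2 U X2 X3 tL_neq0 (rvar_neq0 F 1) G_neq0.
have E2 := q2_of_Y V X2 X4 tL_neq0 (rvar_neq0 F 1) E_neq0.
move: E1 E2; rewrite -phi2 => E1 E2.
split.
  split=> //.
  rewrite fmorph_f4 phi0 phi1 phi3 phi4 !phiC.
  rewrite -(chart4_f _ _ (rvar_neq0 F 3) (rvar_neq0 F 4) E_neq0 G_neq0 (rvar_neq0 F 0)
    (rvar_neq0 F 1) M0 S0).
  by rewrite -E1 -E2.
right; rewrite fmorph_w4 phi1 phi3 phi4 !phiC.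
rewrite (chart4_w tL_neq0 E_neq0 G_neq0 (rvar_neq0 F 1) M0 S0).
by rewrite -E1 -E2.
Qed.

Lemma form_equiv_data56 : form_equiv data5 data6.
Proof.
apply: (form_equiv_dat_moebius ch0 (i := 1)
  (a := quad t U V X2 * num4s t U V U' V' X2 X3 X4)
  (b := quad t U V X2 * num4c t U V U' V' X3 X4)
  (c := quo4s t U V X2 X3 X4) (e := quo4c t U V X3 X4)).
- by rewrite /quad /num4s /t /U /V /U' /V'; indep_tac.
- by rewrite /quad /num4c /t /U /V /U' /V'; indep_tac.
- by rewrite /quo4s /t /U /V; indep_tac.
- by rewrite /quo4c /t /U /V; indep_tac.
- rewrite -!mulrA -mulrBr (moebius_det5 _ _ _ _ _ _ (rvar_neq0 F 3) (rvar_neq0 F 4)).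
  exact: (mulf_neq0 quad_neq0 (mulf_neq0 (mulf_neq0 E_neq0 G_neq0) sym1_neq0)).
move=> phi phiC phiX; rewrite moebius_step6 => phi1.
have phi0 : phi X0 = X0 by exact: phiX.
have phi2 : phi X2 = X2 by exact: phiX.
have phi3 : phi X3 = X3 by exact: phiX.
have phi4 : phi X4 = X4 by exact: phiX.
split.
  split=> //.
  rewrite fmorph_f5 phi0 phi1 phi2 phi3 phi4 !phiC.
  exact: (chart5_f (rvar_neq0 F 3) (rvar_neq0 F 4) (rvar_neq0 F 0) quo4_neq0 den4_neq0
    quad_neq0 sym1_neq0).
left; rewrite fmorphV fmorph_den5 phi1 phi2 phi3 phi4 !phiC.
exact: (chart5_w (rvar_neq0 F 3) (rvar_neq0 F 4) quo4_neq0 den4_neq0 quad_neq0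
  sym1_neq0).
Qed.

Lemma form_equiv_data06 : form_equiv data0 data6.
Proof.
apply: form_equiv_trans form_equiv_data01 _; apply: form_equiv_trans form_equiv_data12 _.
apply: form_equiv_trans form_equiv_data23 _; apply: form_equiv_trans form_equiv_data34 _.
exact: form_equiv_trans form_equiv_data45 form_equiv_data56.
Qed.

End Steps.

(** * Collecting the exponents of the two kernels *)

Section Collect.
Variables (L : fieldType) (t : L).

Definition Qpol x1 x2 y q1 q2 : L :=
  q1 * q2 + v t x1 x2 y * q1 + u t x1 x2 y * q2.

Lemma collect_K x1 x2 y q1 q2 : (fun i => collect i (K t x1 x2 y q1 q2)) =1
  dat ((x1 * x2) * ((x1 - 1) * (x2 - 1)) * ((x1 - t) * (x2 - t)) /
         ((1 - q1 - q2) * Qpol x1 x2 y q1 q2 ^+ 2))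
      ((1 - q1 - q2) / (x1 * x2))
      (q1 / ((x1 - 1) * (x2 - 1)))
      (q2 / ((x1 - t) * (x2 - t)))
      (Qpol x1 x2 y q1 q2 / ((1 - q1 - q2) * q1 * q2)).
Proof.
(* Matrix entries leave the exponents as unevaluated integer differences; each equation settles one
   shape by computation. *)
have e0 (x : L) : x ^ (0 - 0 : int) = 1 by [].
have e1 (x : L) : x ^ (1 - 0 : int) = x by [].
have e2 (x : L) : x ^ (0 - 1 : int) = x^-1 by [].
have e3 (x : L) : x ^ (1 - 0 - 0 : int) = x by [].
have e4 (x : L) : x ^ (0 - 0 - 1 : int) = x^-1 by [].
have e5 (x : L) : x ^ (0 - 1 - 0 : int) = x^-1 by [].
have e6 (x : L) : x ^ (0 - 0 - 0 : int) = 1 by [].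
have e7 (x : L) : x ^ (0 - (0 + 0) : int) = 1 by [].
have e8 (x : L) : x ^ (1 - (0 + 0) : int) = x by [].
have e9 (x : L) : x ^ (0 - (1 + 1) : int) = (x ^+ 2)^-1 by [].
rewrite /dat /collect /K -/(Qpol x1 x2 y q1 q2).
case=> [[|[|[|[|[|j]]]]] //] lt_j; rewrite !big_cons big_nil !mxE /=;
  rewrite ?(e3, e4, e5, e6, e7, e8, e9) ?(e0, e1, e2) ?mulr1 ?mul1r
    ?invfM; ring.
Qed.

Lemma collect_cat (A B : powprod L) i :
  collect i (A ++ B) = collect i A * collect i B.
Proof. exact: big_cat. Qed.

Section Pair.
Variables x1 x2 x3 z y q1 q2 q3 q4 : L.
Hypotheses (t0 : t != 0) (t1 : t - 1 != 0).
Hypotheses (y0 : y != 0) (y1 : y - 1 != 0) (yt : y - t != 0).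
Hypotheses (q10 : q1 != 0) (q20 : q2 != 0) (q30 : q3 != 0) (q40 : q4 != 0).
Hypotheses (l0 : 1 - q1 - q2 != 0) (l'0 : 1 - q3 - q4 != 0).
Let Q := Qpol x1 x2 y q1 q2.
Let Q' := Qpol y x3 z q3 q4.
Hypotheses (Q0 : Q != 0) (Q'0 : Q' != 0).

Lemma f0_Qpol :
  f0 t (uu t x1 x2) (vv t x1 x2) (uu t x3 z) (vv t x3 z) y q1 q2 q3 q4 =
  Q * Q' / ((1 - q1 - q2) * q1 * q2 * ((1 - q3 - q4) * q3 * q4)).
Proof.
have QE : Q = q1 * q2 *
    (1 + vv t x1 x2 * (y - t) / q2 + uu t x1 x2 * (y - 1) / q1).
  by rewrite /Q /Qpol /u /v /uu /vv; field; rewrite t0 t1 q10 q20.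
have Q'E : Q' = q3 * q4 *
    (1 + vv t x3 z * (y - t) / q4 + uu t x3 z * (y - 1) / q3).
  by rewrite /Q' /Qpol /u /v /uu /vv; field; rewrite t0 t1 q30 q40.
rewrite QE Q'E /f0; move: (1 + _ + _) (1 + _ + _) => a b.
by field; rewrite l0 l'0 q10 q20 q30 q40.
Qed.

(** Restores the powers of A, B, C and f4 split off from the form; [c] collects the factors
    depending on x1, x2, x3 alone. *)
Definition gauge0 (c w A B C f : L) : L :=
  c * (w / (A ^+ 3 * f ^+ 2 * B ^+ 2 * C ^+ 2)).

Definition gauge (c0 c1 c2 c3 w A B C f : L) : 'I_5 -> L :=
  dat (gauge0 c0 w A B C f) (c1 * A) (c2 * B) (c3 * C) f.

Lemma collect_pair :
  (fun i => collect i (K t x1 x2 y q1 q2 ++ K t y x3 z q3 q4)) =1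
  gauge (x1 * x2 * x3 * ((x1 - 1) * (x2 - 1) * (x3 - 1)) *
           ((x1 - t) * (x2 - t) * (x3 - t)))
    (x1 * x2 * x3)^-1 ((x1 - 1) * (x2 - 1) * (x3 - 1))^-1
    ((x1 - t) * (x2 - t) * (x3 - t))^-1
    (w0 t y) (A0 y q1 q2 q3 q4) (q1 * q3 / (y - 1)) (q2 * q4 / (y - t))
    (f0 t (uu t x1 x2) (vv t x1 x2) (uu t x3 z) (vv t x3 z) y q1 q2 q3 q4).
Proof.
move=> i; rewrite f0_Qpol collect_cat.
rewrite [collect i (K t x1 x2 y q1 q2)]collect_K.
rewrite [collect i (K t y x3 z q3 q4)]collect_K /w0 /A0.
move: l0 l'0 Q0 Q'0; rewrite -/Q -/Q'.
move: (1 - _ - _) (1 - _ - _) Q Q' => l l' p p' la0 lb0 p0 p'0.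
move: (x1 - 1) (x2 - 1) (x3 - 1) (x1 - t) (x2 - t) (x3 - t) => a1 a2 a3 b1 b2 b3.
case: i => [[|[|[|[|[|j]]]]] //] lt_j; rewrite /gauge /gauge0 /dat /=.
- by field; rewrite y0 y1 yt q10 q20 q30 q40 la0 lb0 p0 p'0.
- by rewrite !invfM; ring.
- by rewrite !invfM; ring.
- by rewrite !invfM; ring.
- by rewrite !invfM; ring.
Qed.

End Pair.

End Collect.

(** * Restoring the split-off constants and powers *)

Lemma fmorph_gauge0 (L L' : fieldType) (phi : {rmorphism L -> L'})
    (c w A B C f : L) : phi (gauge0 c w A B C f) =
  gauge0 (phi c) (phi w) (phi A) (phi B) (phi C) (phi f).
Proof. by rewrite /gauge0 !(rmorphM, fmorphV, rmorphXn). Qed.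

Section Gauge.
Variables (F : fieldType) (n : nat).
Local Notation L := (ratfun F n).

Lemma form_equiv_ext r (d1 d1' d2 d2' : 'I_r.+1 -> L) :
  d1 =1 d1' -> d2 =1 d2' -> form_equiv d1 d2 -> form_equiv d1' d2'.
Proof.
move=> E1 E2 [m [bm Ed Ew]].
by exists m; split=> // [k k0|]; rewrite -E1 -E2 // Ed.
Qed.

(** The map fixes constants and already carries A, B, C and f4 correctly, so these factors pass
    through its pull-back. *)
Lemma form_equiv_gauge (c0 c1 c2 c3 : F) (w A B C f w' A' B' C' f' : L) :
  form_equiv (dat w A B C f) (dat w' A' B' C' f') ->
  form_equiv
    (gauge (rcst n c0) (rcst n c1) (rcst n c2) (rcst n c3) w A B C f)
    (gauge (rcst n c0) (rcst n c1) (rcst n c2) (rcst n c3) w' A' B' C' f').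
Proof.
move=> [m [bm Ed Ew]]; have [dm _] := bm.
have EA : pull_rmorphism dm A' = A by exact: (Ed 1).
have EB : pull_rmorphism dm B' = B by exact: (Ed 2).
have EC : pull_rmorphism dm C' = C by exact: (Ed 3).
have Ef : pull_rmorphism dm f' = f by exact: (Ed 4).
have Ec c : pull_rmorphism dm (rcst n c) = rcst n c by exact: pull_rcst.
exists m; split=> //.
  case=> [[|[|[|[|[|k]]]]] //] lt_k // _; rewrite /gauge /dat /=.
  - by rewrite pullM // pull_rcst // -EA.
  - by rewrite pullM // pull_rcst // -EB.
  - by rewrite pullM // pull_rcst // -EC.
have E : pull_form m (gauge0 (rcst n c0) w' A' B' C' f') =
    gauge0 (rcst n c0) (pull_form m w') A B C f.
  rewrite pull_formE -[pull m _]/(pull_rmorphism dm _) fmorph_gauge0.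
  rewrite Ec EA EB EC Ef /gauge0 pull_formE /=.
  by move: (pull m w') (\det _) (_ ^-1) => x y e; rewrite -!mulrA [y * e]mulrC.
case: Ew => Ew; [left|right]; apply: (etrans E); rewrite [pull_form m w']Ew //.
by rewrite /gauge0 /= mulNr mulrN.
Qed.

End Gauge.

(** * A common normal form for both sides *)

Section Main.
Variables (F : fieldType) (t0 : F).
Hypotheses (ch0 : [pchar F] =i pred0) (t_neq0 : t0 != 0) (t_neq1 : t0 - 1 != 0).
Local Notation L := (ratfun F 5).
Local Notation c := (@rcst F 5).
Local Notation X0 := (rvar F (0 : 'I_5)).
Local Notation X1 := (rvar F (1 : 'I_5)).
Local Notation X2 := (rvar F (2 : 'I_5)).
Local Notation X3 := (rvar F (3 : 'I_5)).
Local Notation X4 := (rvar F (4 : 'I_5)).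

Definition lhs_data (x1 x2 x3 z : F) : 'I_5 -> L := fun i => collect i
  (K (c t0) (c x1) (c x2) X0 X1 X2 ++ K (c t0) X0 (c x3) (c z) X3 X4).

Definition normal_data (x1 x2 x3 z : F) : 'I_5 -> L :=
  gauge (c (x1 * x2 * x3 * ((x1 - 1) * (x2 - 1) * (x3 - 1)) *
           ((x1 - t0) * (x2 - t0) * (x3 - t0))))
    (c (x1 * x2 * x3)^-1) (c ((x1 - 1) * (x2 - 1) * (x3 - 1))^-1)
    (c ((x1 - t0) * (x2 - t0) * (x3 - t0))^-1)
    (den5 (c t0) (uu (c t0) (c x1) (c x2)) (vv (c t0) (c x1) (c x2))
      (uu (c t0) (c x3) (c z)) (vv (c t0) (c x3) (c z)) X1 X2 X3 X4)^-1
    X0 X3 X4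
    (f5 (c t0) (uu (c t0) (c x1) (c x2)) (vv (c t0) (c x1) (c x2))
      (uu (c t0) (c x3) (c z)) (vv (c t0) (c x3) (c z)) X0 X1 X2 X3 X4).

Let ct_neq0 : c t0 != 0.
Proof. by rewrite fmorph_eq0. Qed.

Let ct_neq1 : c t0 - 1 != 0.
Proof. by rewrite -(rmorph1 c) -rmorphB fmorph_eq0. Qed.

Let l_neq0 i j : i != j -> 1 - rvar F i - rvar F j != 0 :> L.
Proof.
move=> ij; rewrite -opprB oppr_eq0; apply: rvar_sub_neq0.
by apply: indepD; [exact: indep1 | apply: indepN; apply: indep_rvar].
Qed.

(** The polynomial is affine in the j-th variable with slope X_i + u, nonzero because u does not
    involve X_i. *)
Let Qpol_neq0 i j (a b y : L) : i != j ->
  indep i a -> indep i b -> indep i y -> indep j a -> indep j b -> indep j y ->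
  Qpol (c t0) a b y (rvar F i) (rvar F j) != 0.
Proof.
move=> ij ia ib iy ja jb jy.
have -> : Qpol (c t0) a b y (rvar F i) (rvar F j) =
    (rvar F i - (- u (c t0) a b y)) * rvar F j + v (c t0) a b y * rvar F i.
  by rewrite /Qpol opprK [RHS]addrC mulrDl addrCA addrA.
apply: indep_lin_neq0; rewrite /u /v.
- by indep_tac; first [assumption | apply: indep_rvar].
- by indep_tac; first [assumption | apply: indep_rvar].
apply/orP; left; apply: rvar_sub_neq0; rewrite /u.
by indep_tac; assumption.
Qed.

Lemma lhs_normal x1 x2 x3 z :
  form_equiv (lhs_data x1 x2 x3 z) (normal_data x1 x2 x3 z).
Proof.
have := form_equiv_gauge
  (x1 * x2 * x3 * ((x1 - 1) * (x2 - 1) * (x3 - 1)) *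
     ((x1 - t0) * (x2 - t0) * (x3 - t0)))
  (x1 * x2 * x3)^-1 ((x1 - 1) * (x2 - 1) * (x3 - 1))^-1
  ((x1 - t0) * (x2 - t0) * (x3 - t0))^-1
  (form_equiv_data06 (uu t0 x1 x2) (vv t0 x1 x2) (uu t0 x3 z) (vv t0 x3 z)
     ch0 t_neq0).
rewrite !fmorph_uu !fmorph_vv; apply: form_equiv_ext => // i.
have v1 : X0 - 1 != 0 by apply: rvar_sub_neq0; apply: indep1.
have vt : X0 - c t0 != 0 by apply: rvar_sub_neq0; apply: indep_rcst.
have l12 := @l_neq0 1 2 isT; have l34 := @l_neq0 3 4 isT.
have Q12 : Qpol (c t0) (c x1) (c x2) X0 X1 X2 != 0.
  by apply: Qpol_neq0 => //; indep_tac.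
have Q34 : Qpol (c t0) X0 (c x3) (c z) X3 X4 != 0.
  by apply: Qpol_neq0 => //; indep_tac.
have E := collect_pair ct_neq0 ct_neq1 (rvar_neq0 F 0) v1 vt (rvar_neq0 F 1) (rvar_neq0 F 2)
  (rvar_neq0 F 3) (rvar_neq0 F 4) l12 l34 Q12 Q34.
apply: esym; apply: (etrans (E i)).
by rewrite !fmorphV !rmorphM !rmorphB !rmorph1.
Qed.

Lemma normal_swap x1 x2 x3 z :
  normal_data x1 x2 x3 z =1 normal_data x1 x3 x2 z.
Proof.
have swap (a b d : F) : a * b * d = a * d * b by rewrite mulrAC.
move=> i; rewrite /normal_data.
rewrite (swap x1 x2 x3) (swap (x1 - 1) _ (x3 - 1)) (swap (x1 - t0) _ (x3 - t0)).
rewrite (den5_swap ct_neq0 ct_neq1).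
rewrite (f5_swap ct_neq0 ct_neq1 _ _ _ _ _ (rvar_neq0 F 3) (rvar_neq0 F 4)).
exact: erefl.
Qed.

Lemma lhs_swap x1 x2 x3 z :
  form_equiv (lhs_data x1 x2 x3 z) (lhs_data x1 x3 x2 z).
Proof.
apply: (form_equiv_trans (lhs_normal x1 x2 x3 z)).
apply: form_equiv_ext (form_equiv_sym (lhs_normal x1 x3 x2 z)) => [i|//].
exact: normal_swap.
Qed.

End Main.

Unset Implicit Arguments.

Theorem theorem2p3p1 (k : fieldType) (t : k) :
  [pchar k] =i pred0 -> t != 0 -> t != 1 ->
  (* the field of rational functions in the parameters x1, x2, x3, z *)
  let F : fieldType := ratfun k 4 in
  let par (i : 'I_4) : ratfun F 5 := rcst 5 (rvar k i : F) in
  let T : ratfun F 5 := rcst 5 (rcst 4 t : F) in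
  let x1 := par 0 in let x2 := par 1 in let x3 := par 2 in let z := par 3 in
  let y := rvar F (0 : 'I_5) in
  let q1 := rvar F (1 : 'I_5) in let q2 := rvar F (2 : 'I_5) in
  let q3 := rvar F (3 : 'I_5) in let q4 := rvar F (4 : 'I_5) in
  exists mu : 'I_5 -> ratfun F 5,
    birational mu /\
    transforms mu
      (K T x1 x2 y q1 q2 ++ K T y x3 z q3 q4)
      (K T x1 x3 y q1 q2 ++ K T y x2 z q3 q4).
Proof.
move=> ch0 t0 t1 F par T x1 x2 x3 z y q1 q2 q3 q4.
have ch0F : [pchar F] =i pred0.
  by move=> p; rewrite (fmorph_pchar (@rcst k 4)) ch0.
have t0F : rcst 4 t != 0 by rewrite fmorph_eq0.
have t1F : rcst 4 t - 1 != 0.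
  by rewrite -(rmorph1 (@rcst k 4)) -rmorphB fmorph_eq0 subr_eq0.
(* The constants are now rational functions of x1, x2, x3, z over k, and the four parameters are the
   variables of that field. *)
have [mu [bmu Emu Wmu]] :=
  lhs_swap ch0F t0F t1F (rvar k 0) (rvar k 1) (rvar k 2) (rvar k 3).
by exists mu.
Qed.
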